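(* For each $z\in\mathbb C$ with $z\ne0$ and $|z|\le1$, the space $\mathcal H_1$ is invariant under $\mathcal Q_z$. More precisely, for every $\varphi\in L_2(m)$, $$\mathcal Q_z\,\mathcal L[\varphi]=\mathcal L\big[z\,(1-M)(1-zM)^{-1}\mathcal K\varphi\big],$$ where $M:L_2(m)\to L_2(m)$ is the multiplication operator $M\varphi(t)=e^{-t}\varphi(t)$ and $\mathcal K:L_2(m)\to L_2(m)$ is the integral operator $$(\mathcal K\varphi)(t)=\int_0^\infty\frac{J_1(2\sqrt{st})}{\sqrt{st}}\,\varphi(s)\,dm(s),$$ $J_p$ denoting the Bessel function of order $p$.
   Context: $m$ is the measure on $\mathbb R^+=(0,\infty)$ given by $dm(t)=\frac{t}{e^t-1}\,dt$. $\mathcal H_1$ is the Hilbert space of all functions of the form $$f(w)=(\mathcal L[\varphi])(w):=\int_0^\infty e^{-tw}\varphi(t)\,dm(t),\qquad\varphi\in L_2(m),$$ (holomorphic in $\{\operatorname{Re}w>-1/2\}$), with inner product $(\mathcal L[\varphi_1],\mathcal L[\varphi_2])=\int_0^\infty\overline{\varphi_1}\,\varphi_2\,dm$. The operator $\mathcal Q_z$ is $$\mathcal Q_zf(w)=\sum_{n=1}^\infty z^n\Big(\frac1{w+n}\Big)^2f\Big(\frac1{w+n}\Big).$$ The operator $(1-M)(1-zM)^{-1}$ is multiplication by the bounded function $\frac{1-e^{-t}}{1-ze^{-t}}$ (the identity when $z=1$). *)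

(* Defs.v *)
From HB Require Import structures.
From mathcomp Require Import all_boot all_order all_algebra.
From mathcomp Require Import complex.
From mathcomp Require Import all_classical all_reals all_analysis.
From mathcomp Require Import measurable_realfun lra ring.

Set Implicit Arguments.
Unset Strict Implicit.
Unset Printing Implicit Defensive.

Import Order.TTheory GRing.Theory Num.Theory.
Import numFieldNormedType.Exports.

Local Open Scope classical_set_scope.
Local Open Scope ring_scope.
Local Open Scope complex_scope.

Definition Rpos {R : realType} : set R := `]0%R, +oo[.

Definition m_density {R : realType} (t : R) : R := t / (expR t - 1).

(* Carried by Rpos, but defined on all Borel sets of R. *)
Definition m {R : realType} (A : set R) : \bar R :=
  (\int[lebesgue_measure]_(t in A `&` Rpos) (m_density t)%:E)%E.

Section m_measure.
Context {R : realType}.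

Lemma measurable_Rpos : measurable (@Rpos R).
Proof. exact: measurable_itv. Qed.

Lemma m_density_ge0 (t : R) : Rpos t -> 0 <= m_density t.
Proof.
rewrite /Rpos /= in_itv /= andbT => t0.
apply: divr_ge0; first exact: ltW.
by rewrite subr_ge0 -expR0 ler_expR ltW.
Qed.

Lemma measurable_m_density : measurable_fun Rpos (@m_density R).
Proof.
apply: open_continuous_measurable_fun; first exact: interval_open.
move=> t; rewrite inE /Rpos /= in_itv /= andbT => t0.
apply: (@cvgM _ _ _ _ id (fun t => (expR t - 1)^-1)); first exact: cvg_id.
apply: cvgV; first by rewrite gt_eqF// subr_gt0 expR_gt1.
by apply: cvgB; [exact: continuous_expR|exact: cvg_cst].
Qed.

Let m0 : m set0 = 0%E :> \bar R.
Proof. by rewrite /m set0I integral_set0. Qed.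

Let m_ge0 (A : set R) : (0 <= m A)%E.
Proof.
by apply: integral_ge0 => t [_ t0]; rewrite lee_fin m_density_ge0.
Qed.

Let m_sigma_additive : semi_sigma_additive (@m R).
Proof.
move=> F mF tF mUF; rewrite /m; apply: cvg_toP.
  apply: ereal_nondecreasing_is_cvgn => a b ab.
  by apply: lee_sum_nneg_natr => // k _ _; exact: m_ge0.
rewrite setI_bigcupl ge0_integral_bigcup//.
- by move=> k; apply: measurableI; [exact: mF|exact: measurable_Rpos].
- apply/measurable_EFinP; apply: (measurable_funS _ _ measurable_m_density).
    exact: measurable_Rpos.
  by move=> t [k _ []].
- by move=> t [k _ [_ t0]]; rewrite lee_fin m_density_ge0.
- exact: trivIset_setIr.
Qed.

HB.instance Definition _ := isMeasure.Build _ _ _ (@m R)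
  m0 m_ge0 m_sigma_additive.

End m_measure.

Section operators.
Context {R : realType}.
Implicit Types (phi f : R -> R[i]) (z w : R[i]) (s t : R).

(* Euler's formula. *)
Definition expC z : R[i] :=
  (expR (complex.Re z))%:C * (cos (complex.Im z) +i* sin (complex.Im z)).

(* The library integrates real functions: complex integrals are taken
   componentwise. *)
Definition cintegrable f : Prop :=
  m.-integrable Rpos (EFin \o (fun t => complex.Re (f t))) /\
  m.-integrable Rpos (EFin \o (fun t => complex.Im (f t))).

Definition cintegral f : R[i] :=
  (\int[m]_(t in Rpos) complex.Re (f t)) +i*
  (\int[m]_(t in Rpos) complex.Im (f t)).

(* Elements of L_2(m) are handled through representatives; values outside Rpos
   are irrelevant. *)
Definition L2m : set (R -> R[i]) := [set phi : R -> R[i] |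
  [/\ measurable_fun Rpos (fun t => complex.Re (phi t)),
      measurable_fun Rpos (fun t => complex.Im (phi t)) &
      (\int[m]_(t in Rpos) (ComplexField.Normc.normc (phi t) ^+ 2)%:E < +oo)%E]].

Definition laplace phi w : R[i] :=
  cintegral (fun t => expC (- (t%:C * w)) * phi t).

Definition halfplane : set R[i] := [set w | - 2^-1 < complex.Re w].

(* Functions on the half-plane are total functions considered only up to their
   values on the half-plane. *)
Definition H1 : set (R[i] -> R[i]) := [set f |
  exists2 phi, L2m phi & forall w, halfplane w -> f w = laplace phi w].

Definition opQ_partial z (f : R[i] -> R[i]) w (N : nat) : R[i]^o :=
  \sum_(1 <= n < N.+1)
    z ^+ n * ((w + n%:R)^-1) ^+ 2 * f ((w + n%:R)^-1).

Definition opQ z (f : R[i] -> R[i]) w : R[i] := limn (opQ_partial z f w).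

Definition besselJ (p : nat) (x : R) : R :=
  limn (series (fun k : nat =>
    (-1) ^+ k / (k`! * (k + p)`!)%:R * (x / 2) ^+ (2 * k + p)%N)).

Definition kerK t s : R :=
  besselJ 1 (2 * Num.sqrt (s * t)) / Num.sqrt (s * t).

Definition opK phi t : R[i] := cintegral (fun s => (kerK t s)%:C * phi s).

Definition opM phi t : R[i] := (expR (- t))%:C * phi t.

(* (1 - M)(1 - zM)^-1; for z = 1 the operator 1 - zM has no bounded inverse, so
   the product is read as one bounded multiplication operator. *)
Definition opT z phi t : R[i] :=
  (1 - (expR (- t))%:C) / (1 - z * (expR (- t))%:C) * phi t.

Lemma one_sub_zM_neq0 z t : `|z| <= 1 -> Rpos t ->
  1 - z * (expR (- t))%:C != 0.
Proof.
rewrite /Rpos /= in_itv /= andbT => z1 t0.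
rewrite subr_eq0; apply/eqP => /(congr1 Num.norm).
rewrite normr1 normrM => h.
have e0 : 0 <= (expR (- t))%:C :> R[i] by rewrite lecR expR_ge0.
have e1 : (expR (- t))%:C < 1 :> R[i] by rewrite ltcR expR_lt1 oppr_lt0.
move: h; rewrite (ger0_norm e0) => h.
have : `|z| * (expR (- t))%:C < 1.
  by apply: le_lt_trans e1; rewrite ler_piMl.
by rewrite -h ltxx.
Qed.

Lemma opTP z phi t : `|z| <= 1 -> Rpos t ->
  opT z phi t - z * opM (opT z phi) t = phi t - opM phi t.
Proof.
move=> z1 t0; have h := one_sub_zM_neq0 z1 t0.
by rewrite /opM /opT; field.
Qed.

Lemma opT1 phi t : Rpos t -> opT 1 phi t = phi t.
Proof.
move=> t0; have h : 1 - 1 * (expR (- t))%:C != 0 :> R[i].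
  by apply: one_sub_zM_neq0 => //; rewrite normr1.
by rewrite /opT mul1r divff ?mul1r// -[X in 1 - X]mul1r.
Qed.

End operators.

(* Main.v *)
(** Write [g(x) = sum_k (-1)^k x^k / (k! (k+1)!)], so that the kernel of [K] is
    [g (s t)]. Integrating termwise against [t e^(-tu)] gives
    [u^(-2) e^(-s/u) = int_0^oo e^(-tu) t g(s t) dt] whenever [Re u > 0]. Hence,
    by Fubini, [u^(-2) L[phi](1/u) = int_0^oo e^(-tu) t (K phi)(t) dt]; with
    [u = w + n] the sum over [n] is a geometric series in [z e^(-t)], and
    [t e^(-t) = (1 - e^(-t)) dm/dt] turns its sum into [z (1 - M)(1 - zM)^(-1)].
    Fubini and the boundedness of [K phi] rest on [|g| <= 1] on the positive
    half-line, which the decreasing energy [x g'^2 + g^2] of the equation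
    [x g'' + 2 g' + g = 0] provides. *)

Require Import Defs.
From HB Require Import structures.
From mathcomp Require Import all_boot all_order all_algebra.
From mathcomp Require Import complex.
From mathcomp Require Import all_classical all_reals all_analysis.
From mathcomp Require Import measurable_realfun lra ring.

Set Implicit Arguments.
Unset Strict Implicit.
Unset Printing Implicit Defensive.

Import Order.TTheory GRing.Theory Num.Theory.
Import numFieldNormedType.Exports.

Local Open Scope classical_set_scope.
Local Open Scope ring_scope.
Local Open Scope complex_scope.

Import ComplexField.Normc.

(** Three exchanges of a limit or integral shape the proof, and each needs its own majorant.
    Termwise integration requires a bound on the partial sums of [g], about which the energy says
    nothing; their growth in [t] must stay below the decay [e^(-t Re u)] for every [Re u > 0], hence
    a bound [e^a e^b] at the argument [a b], in which the share of [t] can be scaled down. In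
    Fubini, [|g| <= 1] and [|phi| <= 1 + |phi|^2] give a product majorant, integrable because [m] is
    finite. The sum over [n] cannot use decay of [z^n], since [|z| = 1] is allowed: the geometric
    majorant [e^(-t) / (1 - e^(-t))] is singular at 0, and the factor [t] of the weight [t e^(-tu)]
    turns it into [dm/dt]. The bound [dm/dt <= 2 e^(-t/2)] then fits the half-plane [Re w > -1/2].
    Until that last exchange the integrals in [t] are taken against Lebesgue measure. *)

Section complex_components.
Context {R : realType}.
Implicit Types (x y z : R[i]) (a b : R).

Lemma ReD x y : complex.Re (x + y) = complex.Re x + complex.Re y.
Proof. by case: x y => [? ?] [? ?]. Qed.

Lemma ImD x y : complex.Im (x + y) = complex.Im x + complex.Im y.
Proof. by case: x y => [? ?] [? ?]. Qed.

Lemma ReM x y : complex.Re (x * y) =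
  complex.Re x * complex.Re y - complex.Im x * complex.Im y.
Proof. by case: x y => [? ?] [? ?]. Qed.

Lemma ImM x y : complex.Im (x * y) =
  complex.Re x * complex.Im y + complex.Im x * complex.Re y.
Proof. by case: x y => [? ?] [? ?]. Qed.

Lemma complex_eq x y :
  complex.Re x = complex.Re y -> complex.Im x = complex.Im y -> x = y.
Proof. by case: x y => [? ?] [? ?] /= -> ->. Qed.

Lemma realcX a n : (a ^+ n)%:C = a%:C ^+ n.
Proof. exact: rmorphXn. Qed.

Lemma realcM a b : (a * b)%:C = a%:C * b%:C.
Proof. exact: rmorphM. Qed.

Lemma realcV a : (a^-1)%:C = a%:C^-1.
Proof. exact: fmorphV. Qed.

Lemma realc_nat n : (n%:R)%:C = n%:R :> R[i].
Proof. exact: rmorph_nat. Qed.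

Lemma realc_sum (I : Type) (r : seq I) (P : pred I) (F : I -> R) :
  (\sum_(i <- r | P i) F i)%:C = \sum_(i <- r | P i) (F i)%:C :> R[i].
Proof. exact: (raddf_sum (real_complex R)). Qed.

Lemma Re_sum (I : Type) (r : seq I) (P : pred I) (F : I -> R[i]) :
  complex.Re (\sum_(i <- r | P i) F i) = \sum_(i <- r | P i) complex.Re (F i).
Proof. by apply: (big_morph (@complex.Re R)) => [x y|//]; rewrite ReD. Qed.

Lemma Im_sum (I : Type) (r : seq I) (P : pred I) (F : I -> R[i]) :
  complex.Im (\sum_(i <- r | P i) F i) = \sum_(i <- r | P i) complex.Im (F i).
Proof. by apply: (big_morph (@complex.Im R)) => [x y|//]; rewrite ImD. Qed.

Lemma Re_nat n : complex.Re (n%:R : R[i]) = n%:R.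
Proof. by elim: n => // n IH; rewrite -!natr1 ReD IH. Qed.

Lemma Im_nat n : complex.Im (n%:R : R[i]) = 0.
Proof. by elim: n => // n IH; rewrite -natr1 ImD IH addr0. Qed.

Lemma normc_ge0 x : 0 <= normc x.
Proof. by case: x => a b; exact: sqrtr_ge0. Qed.

Lemma normc_sqr x :
  normc x ^+ 2 = complex.Re x ^+ 2 + complex.Im x ^+ 2.
Proof. by case: x => a b; rewrite /= sqr_sqrtr// addr_ge0// sqr_ge0. Qed.

Lemma normc_opp x : normc (- x) = normc x.
Proof. by case: x => a b; rewrite /= !sqrrN. Qed.

Lemma normcX x n : normc (x ^+ n) = normc x ^+ n.
Proof.
by elim: n => [|n IH]; rewrite ?expr0 ?normc1// !exprS normcM IH.
Qed.

Lemma normcR a : normc a%:C = `|a|.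
Proof. by rewrite /= expr0n addr0 sqrtr_sqr. Qed.

Lemma normc_nat n : normc (n%:R : R[i]) = n%:R.
Proof.
have -> : n%:R = (n%:R : R)%:C by apply: complex_eq; rewrite ?Re_nat ?Im_nat.
by rewrite normcR normr_nat.
Qed.

Lemma norm_Re_le x : `|complex.Re x| <= normc x.
Proof.
case: x => a b; rewrite /= -sqrtr_sqr ler_wsqrtr// lerDl; exact: sqr_ge0.
Qed.

Lemma norm_Im_le x : `|complex.Im x| <= normc x.
Proof.
case: x => a b; rewrite /= -sqrtr_sqr ler_wsqrtr// lerDr; exact: sqr_ge0.
Qed.

Lemma normc_le_norm1 x : normc x <= `|complex.Re x| + `|complex.Im x|.
Proof.
rewrite -(@ler_pXn2r _ 2) ?nnegrE ?normc_ge0 ?addr_ge0//.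
rewrite normc_sqr sqrrD !real_normK ?num_real//.
by rewrite -addrA [_ *+ 2 + _]addrC addrA lerDl mulrn_wge0// mulr_ge0.
Qed.

Lemma normcD_le x y : normc (x + y) <= normc x + normc y.
Proof. exact: le_normcD. Qed.

Lemma normc_sum (I : Type) (r : seq I) (P : pred I) (F : I -> R[i]) :
  normc (\sum_(i <- r | P i) F i) <= \sum_(i <- r | P i) normc (F i).
Proof.
elim/big_ind2 : _ => [|x1 x2 y1 y2 h1 h2|//]; first by rewrite normc0.
by rewrite (le_trans (normcD_le _ _))// lerD.
Qed.

Lemma normC_normc x : `|x| = (normc x)%:C.
Proof. by []. Qed.

End complex_components.

(** * Convergence of complex sequences *)

Section complex_cvg.
Context {R : realType}.
Implicit Types (u v : nat -> R[i]) (l k : R[i]).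

(** Complex integrals are pairs of real ones, so dominated convergence yields limits of components;
    [ccvg_cvg] converts them into limits in [R[i]^o], where [opQ] takes its limit. *)
Definition ccvg u l : Prop :=
  (fun n => complex.Re (u n)) @ \oo --> complex.Re l /\
  (fun n => complex.Im (u n)) @ \oo --> complex.Im l.

Lemma ccvg_normc u l (e : R ^nat) : (forall n, normc (u n - l) <= e n) ->
  e @ \oo --> 0 -> ccvg u l.
Proof.
move=> ule e0; split; apply/cvgrPdist_le => _/posnumP[d];
  have /cvgrPdist_le/(_ d%:num ltac:(by [])) := e0;
  apply: filterS => n; rewrite sub0r normrN => h; rewrite distrC;
  apply: le_trans (le_trans (ler_norm _) h); apply: le_trans (ule n).
- by rewrite -raddfB /=; exact: (norm_Re_le (u n - l)).
- by rewrite -raddfB /=; exact: (norm_Im_le (u n - l)).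
Qed.

Lemma ccvg_dist u l : ccvg u l -> (fun n => normc (u n - l)) @ \oo --> 0.
Proof.
move=> [ur ui].
apply: (@squeeze_cvgr _ _ _ _ (cst 0)
  (fun n => `|complex.Re (u n) - complex.Re l| + `|complex.Im (u n) - complex.Im l|)).
- apply: nearW => n; rewrite normc_ge0 /=.
  by apply: le_trans (normc_le_norm1 _) _; case: (u n) (l) => [? ?] [? ?].
- exact: cvg_cst.
- have : `|complex.Re (u n) - complex.Re l| + `|complex.Im (u n) - complex.Im l|
      @[n --> \oo] --> `|complex.Re l - complex.Re l| + `|complex.Im l - complex.Im l|.
    by apply: cvgD; apply: cvg_norm; apply: cvgB => //; exact: cvg_cst.
  by rewrite !subrr !normr0 addr0.
Qed.

(** The norm of [R[i]^o] is complex-valued, so the radius [e] is itself a complex number; [0 < e]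
    makes its imaginary part vanish and leaves an ordinary real radius. *)
Lemma ccvg_cvg u l : ccvg u l -> (u : nat -> R[i]^o) @ \oo --> (l : R[i]^o).
Proof.
move=> /ccvg_dist h; apply/cvgrPdist_lt => /= e e0.
have : 0 < complex.Re e by move: e0; rewrite ltcE => /andP[].
have -> : e = (complex.Re e)%:C.
  by move: e0; rewrite ltcE; case: (e) => a b /= /andP[/eqP ->].
move=> {}e0; have /cvgrPdist_lt/(_ _ e0) := h.
apply: filterS => n; rewrite sub0r normrN ger0_norm ?normc_ge0// => hn.
by rewrite distrC normC_normc ltcR.
Qed.

Lemma ccvg_cst l : ccvg (fun=> l) l.
Proof. by split; exact: cvg_cst. Qed.

Lemma ccvgM u v l k : ccvg u l -> ccvg v k -> ccvg (fun n => u n * v n) (l * k).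
Proof.
move=> [ur ui] [vr vi]; split.
- rewrite ReM; under eq_fun do rewrite ReM.
  by apply: cvgB; apply: cvgM.
- rewrite ImM; under eq_fun do rewrite ImM.
  by apply: cvgD; apply: cvgM.
Qed.

Lemma ccvg_unique u l k : ccvg u l -> ccvg u k -> l = k.
Proof.
by move=> [ur ui] [vr vi]; apply: complex_eq; [move: vr|move: vi];
  apply: cvg_unique.
Qed.

End complex_cvg.

(** * Complex-valued calculus *)

Section complex_derivative.
Context {R : realType}.
Implicit Types (f g : R -> R[i]) (t : R) (v w : R[i]).

Lemma Re_expC v :
  complex.Re (expC v) = expR (complex.Re v) * cos (complex.Im v).
Proof. by rewrite /expC ReM /= mul0r subr0. Qed.

Lemma Im_expC v :
  complex.Im (expC v) = expR (complex.Re v) * sin (complex.Im v).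
Proof. by rewrite /expC ImM /= mul0r addr0. Qed.

Definition cderive f t v : Prop :=
  is_derive t 1 (fun s => complex.Re (f s)) (complex.Re v) /\
  is_derive t 1 (fun s => complex.Im (f s)) (complex.Im v).

Lemma is_derive_mul (f g : R -> R) t a b :
  is_derive t 1 f a -> is_derive t 1 g b ->
  is_derive t 1 (fun s => f s * g s) (a * g t + f t * b).
Proof.
move=> fa gb; have := is_deriveM fa gb.
by move=> h; apply: is_derive_eq => //; rewrite addrC /GRing.scale /= mulrC.
Qed.

Lemma cderiveM f g t v w : cderive f t v -> cderive g t w ->
  cderive (fun s => f s * g s) t (v * g t + f t * w).
Proof.
move=> [fr fi] [gr gi]; split.
- under eq_fun do rewrite ReM.
  by apply: is_derive_eq; rewrite ReD !ReM /GRing.scale /=; ring.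
- under eq_fun do rewrite ImM.
  by apply: is_derive_eq; rewrite ImD !ImM /GRing.scale /=; ring.
Qed.

Lemma cderiveD f g t v w : cderive f t v -> cderive g t w ->
  cderive (fun s => f s + g s) t (v + w).
Proof.
move=> [fr fi] [gr gi]; split.
- under eq_fun do rewrite ReD.
  by apply: is_derive_eq; rewrite ReD.
- under eq_fun do rewrite ImD.
  by apply: is_derive_eq; rewrite ImD.
Qed.

Lemma cderive_cst v t : cderive (fun=> v) t 0.
Proof. by split; exact: is_derive_cst. Qed.

Lemma cderiveZ f t v w : cderive f t v -> cderive (fun s => w * f s) t (w * v).
Proof.
by move=> /(cderiveM (cderive_cst w t)); rewrite mul0r add0r.
Qed.

Lemma cderive_pow n t :
  cderive (fun s => (s ^+ n)%:C) t (n%:R * t ^+ n.-1)%:C.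
Proof.
split; last exact: is_derive_cst.
have := @is_deriveX _ _ (@id R) n t 1 1 (is_derive_id _ _).
by rewrite exprfctE /GRing.scale /= mulr1.
Qed.

Lemma cderive_expC v t :
  cderive (fun s => expC (s%:C * v)) t (v * expC (t%:C * v)).
Proof.
have D (a : R) : is_derive t 1 (fun s => s * a) a.
  by have := is_derive_mul (is_derive_id t 1) (is_derive_cst a t 1);
     rewrite mul1r mulr0 addr0.
have DE : is_derive t 1 (fun s => expR (s * complex.Re v))
    (expR (t * complex.Re v) * complex.Re v).
  exact: (is_derive1_comp (is_derive_expR _) (D _)).
have DC : is_derive t 1 (fun s => cos (s * complex.Im v))
    (- sin (t * complex.Im v) * complex.Im v).
  exact: (is_derive1_comp (is_derive_cos _) (D _)).
have DS : is_derive t 1 (fun s => sin (s * complex.Im v))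
    (cos (t * complex.Im v) * complex.Im v).
  exact: (is_derive1_comp (is_derive_sin _) (D _)).
have e s : expC (s%:C * v) =
    (expR (s * complex.Re v) * cos (s * complex.Im v)) +i*
    (expR (s * complex.Re v) * sin (s * complex.Im v)).
  by rewrite /expC; apply: complex_eq;
    rewrite ?Re_expC ?Im_expC ReM ImM /= !mul0r subr0 addr0.
split; under eq_fun do rewrite e /=; rewrite e.
- by apply: is_derive_eq; rewrite ReM /GRing.scale /=; ring.
- by apply: is_derive_eq; rewrite ImM /GRing.scale /=; ring.
Qed.

(** The mean value theorem has no equality form for complex values. It is applied to each component
    with its own intermediate point, whence the factor 2. *)
Lemma cderive_mvt f (df : R -> R[i]) (M : R) :
  (forall t, cderive f t (df t)) ->
  (forall t, 0 <= t <= 1 -> normc (df t) <= M) -> normc (f 1 - f 0) <= 2 * M.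
Proof.
move=> Df dfM; apply: le_trans (normc_le_norm1 _) _.
rewrite mulr2n mulrDl mul1r; apply: lerD.
- have [||c] := @MVT_segment R (fun s => complex.Re (f s))
      (fun s => complex.Re (df s)) 0 1 ler01.
  + by move=> x _; have [] := Df x.
  + apply: derivable_within_continuous => x _.
    by have [h _] := Df x; exact: (@ex_derive _ _ _ _ _ _ _ h).
  + rewrite in_itv /= => c01 e.
    rewrite (_ : complex.Re (f 1 - f 0) = complex.Re (df c)); last first.
      by rewrite raddfB /= e subr0 mulr1.
    by rewrite (le_trans (norm_Re_le _))// dfM.
- have [||c] := @MVT_segment R (fun s => complex.Im (f s))
      (fun s => complex.Im (df s)) 0 1 ler01.
  + by move=> x _; have [] := Df x.
  + apply: derivable_within_continuous => x _.
    by have [_ h] := Df x; exact: (@ex_derive _ _ _ _ _ _ _ h).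
  + rewrite in_itv /= => c01 e.
    rewrite (_ : complex.Im (f 1 - f 0) = complex.Im (df c)); last first.
      by rewrite raddfB /= e subr0 mulr1.
    by rewrite (le_trans (norm_Im_le _))// dfM.
Qed.

End complex_derivative.

Section complex_exponential.
Context {R : realType}.
Implicit Types (v w : R[i]) (t : R).

Lemma expC0 : expC 0 = 1 :> R[i].
Proof. by rewrite /expC /= expR0 cos0 sin0 mul1r. Qed.

Lemma expCD v w : expC (v + w) = expC v * expC w.
Proof.
by apply: complex_eq; rewrite !(ReM, ImM, Re_expC, Im_expC) ReD ImD expRD
  ?cosD ?sinD; ring.
Qed.

Lemma normc_expC v : normc (expC v) = expR (complex.Re v).
Proof.
rewrite /expC normcM normcR /= cos2Dsin2 sqrtr1 mulr1.
by rewrite ger0_norm// expR_ge0.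
Qed.

Lemma expCN v : expC (- v) * expC v = 1.
Proof. by rewrite -expCD addNr expC0. Qed.

Lemma expCMn v n : expC (v *+ n) = expC v ^+ n.
Proof.
by elim: n => [|n IH]; rewrite ?mulr0n ?expC0// mulrS expCD IH exprS.
Qed.

Lemma expCR t : expC t%:C = (expR t)%:C.
Proof. by rewrite /expC /= cos0 sin0 mulr1. Qed.

Definition expC_partial v (n : nat) : R[i] := \sum_(0 <= k < n) v ^+ k / k`!%:R.

(** Differentiation lowers the partial sum by one term. In the product with [expC (- s v)]
    everything therefore cancels except the last Taylor term. *)
Lemma cderive_expC_partial v n t :
  cderive (fun s => expC_partial (s%:C * v) n.+1) t
    (v * expC_partial (t%:C * v) n).
Proof.
rewrite /expC_partial; elim: n => [|n IH].
  rewrite big_nil mulr0; under eq_fun do rewrite big_nat1 expr0.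
  exact: cderive_cst.
under eq_fun do rewrite big_nat_recr//=.
rewrite [in X in cderive _ _ X]big_nat_recr//= mulrDr; apply: cderiveD => //.
have := cderiveZ (v ^+ n.+1 / (n.+1)`!%:R) (cderive_pow n.+1 t).
congr cderive.
- apply/funext => s; rewrite exprMn realcX; ring.
- rewrite exprMn exprS factS /= realcM realcX realc_nat natrM invfM.
  have : (n.+1%:R : R[i]) != 0 by rewrite pnatr_eq0.
  have : (n`!%:R : R[i]) != 0 by rewrite pnatr_eq0 -lt0n fact_gt0.
  by move=> h1 h2; field; rewrite nat1r h1.
Qed.

Lemma exp_coeff_le_expR (x : R) n : 0 <= x -> x ^+ n / n`!%:R <= expR x.
Proof.
move=> x0; case: n => [|n].
  by rewrite expr0 fact0 divr1 -expR0 ler_expR.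
by apply: le_trans (expR_ge1Dxn n x0); rewrite lerDr.
Qed.

(* With [P n] the partial sums, [s |-> expC (- s v) * P n (s v)] has derivative
   [- v expC (- s v) (s v) ^ (n-1) / (n-1)!], hence is nearly constant on
   [[0, 1]]. *)
Lemma expC_series v : ccvg (expC_partial v) (expC v).
Proof.
pose h n s := expC (s%:C * (- v)) * expC_partial (s%:C * v) n.+1.
pose dh n s := - v * expC (s%:C * (- v)) * ((s%:C * v) ^+ n / n`!%:R).
have Dh n s : cderive (h n) s (dh n s).
  have := cderiveM (cderive_expC (- v) s) (cderive_expC_partial v n s).
  congr cderive; rewrite /dh /expC_partial big_nat_recr//=; ring.
pose N := normc v.
have N0 : 0 <= N by exact: normc_ge0.
have dhM n s : 0 <= s <= 1 -> normc (dh n s) <= N * expR N * (N ^+ n / n`!%:R).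
  move=> /andP[s0 s1]; rewrite /dh normcM normcM normc_expC normc_opp normcM normcV normcX.
  rewrite normcM normc_nat normcR ger0_norm//.
  apply: ler_pM; rewrite ?mulr_ge0 ?expR_ge0 ?invr_ge0 ?exprn_ge0 ?mulr_ge0//.
    rewrite ler_wpM2l// ler_expR ReM /= mul0r subr0.
    apply: le_trans (ler_norm _) _; rewrite normrM ger0_norm//.
    apply: le_trans (ler_piMl (normr_ge0 _) s1) _.
    by rewrite (le_trans (norm_Re_le _))// normc_opp.
  rewrite ler_wpM2r ?invr_ge0// lerXn2r ?nnegrE ?mulr_ge0//.
  by rewrite ler_piMl.
have hE n : normc (expC_partial v n.+1 - expC v) <=
    expR (complex.Re v) * (2 * (N * expR N * exp_coeff N n)).
  have := cderive_mvt (Dh n) (@dhM n).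
  have -> : h n 0 = 1.
    rewrite /h !mul0r expC0 mul1r /expC_partial big_nat_recl// expr0 fact0 divr1.
    by rewrite big1 ?addr0// => i _; rewrite expr0n mul0r.
  rewrite /h !mul1r => hle.
  rewrite (_ : _ - _ = expC v * (expC (- v) * expC_partial v n.+1 - 1)).
    by rewrite normcM normc_expC ler_wpM2l// expR_ge0.
  by rewrite mulrBr mulr1 mulrA [expC v * _]mulrC expCN mul1r.
have : ccvg (fun n => expC_partial v (n + 1)) (expC v).
  apply: (@ccvg_normc _ _ _
    (fun n => expR (complex.Re v) * (2 * (N * expR N * exp_coeff N n)))).
    by move=> n; rewrite addn1.
  rewrite -[X in _ --> X](mulr0 (expR (complex.Re v))).
  apply: cvgM; first exact: cvg_cst.
  rewrite -[X in _ --> X](mulr0 2); apply: cvgM; first exact: cvg_cst.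
  rewrite -[X in _ --> X](mulr0 (N * expR N)).
  by apply: cvgM; [exact: cvg_cst|exact: cvg_exp_coeff].
move=> [hr hi]; split.
- by rewrite -(@cvg_shiftn 1).
- by rewrite -(@cvg_shiftn 1).
Qed.

End complex_exponential.

(** * The Bessel kernel *)

Section bessel_clifford.
Context {R : realType}.
Implicit Types (j k n : nat) (x : R).

(** With the Bessel-Clifford functions [C_p(x) = sum_k (-x)^k / (k! (k+p)!)], which satisfy
    [C_p' = - C_(p+1)], these are the Taylor coefficients of [(-1)^j C_(j+1)]. The family is thus
    closed under differentiation. *)
Definition bc_coeff j k : R := (-1) ^+ (k + j) / (k`! * (k + j.+1)`!)%:R.

(* [bessel_clifford 0 x] is [J_1(2 sqrt x) / sqrt x], and [bessel_clifford j] is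
   its [j]-th derivative. *)
Definition bessel_clifford j x : R := limn (pseries (bc_coeff j) x).

Lemma norm_bc_coeff j k : `|bc_coeff j k| <= k`!%:R^-1.
Proof.
rewrite normrM normrX normrN1 expr1n mul1r ger0_norm ?invr_ge0//.
rewrite lef_pV2 ?posrE ?ltr0n ?muln_gt0 ?fact_gt0// ler_nat.
by rewrite leq_pmulr// fact_gt0.
Qed.

Lemma is_cvg_pseries_bc j x : cvgn (pseries (bc_coeff j) x).
Proof.
apply: normed_cvg; apply: series_le_cvg (is_cvg_series_exp_coeff `|x|).
- by move=> n; exact: normr_ge0.
- by move=> n; exact: exp_coeff_ge0.
- move=> n; rewrite exp_coeffE /= normrM normrX ler_wpM2r ?exprn_ge0//.
  exact: norm_bc_coeff.
Qed.

Lemma pseries_diffs_bc j : pseries_diffs (bc_coeff j) = bc_coeff j.+1.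
Proof.
apply/funext => k; rewrite /pseries_diffs /bc_coeff !addSnnS factS -mulnA.
by rewrite natrM invfM [LHS]mulrCA mulVKf// pnatr_eq0.
Qed.

Lemma is_derive_bc j x : is_derive x 1 (bessel_clifford j) (bessel_clifford j.+1 x).
Proof.
rewrite /bessel_clifford -pseries_diffs_bc.
(* The series converge everywhere, so any radius beyond [|x|] will do. *)
apply: (@pseries_snd_diffs R (bc_coeff j) (`|x| + 1)).
- exact: is_cvg_pseries_bc.
- by rewrite pseries_diffs_bc; exact: is_cvg_pseries_bc.
- by rewrite !pseries_diffs_bc; exact: is_cvg_pseries_bc.
- by rewrite [ltRHS]ger0_norm ?addr_ge0// ltrDl.
Qed.

Lemma bc0 : bessel_clifford 0 0 = 1.
Proof.
apply: lim_near_cst => //; exists 1%N => // -[//|n] _ /=.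
rewrite /pseries /series /= big_nat_recl// big1 => [|i _].
  by rewrite /bc_coeff expr0 addn0 expr0 !fact0 mul1n factS fact0 invr1 !mulr1 addr0.
by rewrite expr0n mulr0.
Qed.

(** This is the coefficient of [x^(k+1)] in [x g'' + 2 g' + g]; the factor [x] shifts the index of
    [g''] by one. *)
Lemma bc_coeff_rec k :
  bc_coeff 2 k + 2 * bc_coeff 1 k.+1 + bc_coeff 0 k.+1 = 0.
Proof.
rewrite /bc_coeff addn0 addn1 !addnS !addn0 !factS !natrM !exprS.
have h1 : (k.+1%:R : R) != 0 by rewrite pnatr_eq0.
have h2 : (k.+2%:R : R) != 0 by rewrite pnatr_eq0.
have h3 : (k.+3%:R : R) != 0 by rewrite pnatr_eq0.
have h4 : (k`!%:R : R) != 0 by rewrite pnatr_eq0 -lt0n fact_gt0.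
have e2 : k.+2%:R = k.+1%:R + 1 :> R by rewrite natr1.
have e3 : k.+3%:R = k.+1%:R + 2 :> R by rewrite -addn2 natrD.
move: h2 h3; rewrite e2 e3; move: h1; move: (k.+1%:R : R) => K h1 h2 h3.
by field; rewrite h1 h2 h3 h4.
Qed.

(** The partial sums of [g'] and [g] are taken one term longer than that of [g''], to match the
    factor [x]. The combination then vanishes exactly for every [n]: its increment is [x^(n+1)]
    times [bc_coeff_rec], and its first value is [2 g'(0) + g(0) = 0]. *)
Lemma bc_ode x : x * bessel_clifford 2 x + 2 * bessel_clifford 1 x
  + bessel_clifford 0 x = 0.
Proof.
have c j : pseries (bc_coeff j) x n @[n --> \oo] --> bessel_clifford j x.
  exact: is_cvg_pseries_bc.
have c' j : pseries (bc_coeff j) x (n + 1)%N @[n --> \oo] --> bessel_clifford j x.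
  by rewrite (@cvg_shiftn 1 _ (pseries (bc_coeff j) x)); exact: c.
have h : x * pseries (bc_coeff 2) x n + 2 * pseries (bc_coeff 1) x (n + 1)%N
    + pseries (bc_coeff 0) x (n + 1)%N @[n --> \oo] -->
    x * bessel_clifford 2 x + 2 * bessel_clifford 1 x + bessel_clifford 0 x.
  apply: cvgD; last exact: c'.
  apply: cvgD; apply: cvgM; [exact: cvg_cst|exact: c|exact: cvg_cst|exact: c'].
rewrite -(cvg_lim _ h)//; apply: lim_near_cst => //; apply: nearW => n.
rewrite /pseries /series /= addn1; elim: n => [|n IH].
  rewrite big_nil !big_nat1 /bc_coeff !factS !fact0 !muln1.
  by rewrite !(expr0, expr1, mulr0, mulr1, add0r, add0n, addn0); field.
rewrite big_nat_recr//= ![\sum_(0 <= i < n.+2) _]big_nat_recr//=.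
have hc := bc_coeff_rec n; move: IH hc.
set A := \sum_(0 <= i < n) _; set B := \sum_(0 <= i < n.+1) _.
set C := \sum_(0 <= i < n.+1) _; rewrite [x ^+ n.+1]exprS.
set a := bc_coeff 2 n; set b := bc_coeff 1 n.+1; set c0 := bc_coeff 0 n.+1.
move=> h1 h2; rewrite -[RHS](addr0 (0 : R)) -{1}h1 -(mul0r (x * x ^+ n)) -h2.
by ring.
Qed.

Lemma continuous_bc j : continuous (bessel_clifford j).
Proof.
move=> x; apply: differentiable_continuous; apply/derivable1_diffP.
by have h := is_derive_bc j x; exact: (@ex_derive _ _ _ _ _ _ _ h).
Qed.

(* The energy [x g' ^ 2 + g ^ 2] has derivative [- 3 g' ^ 2] along the equation
   [x g'' + 2 g' + g = 0]. *)
Lemma norm_bc_le1 x : 0 <= x -> `|bessel_clifford 0 x| <= 1.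
Proof.
move=> x0.
pose E (y : R) := y * (bessel_clifford 1 y * bessel_clifford 1 y)
  + bessel_clifford 0 y * bessel_clifford 0 y.
have DE (y : R) : is_derive y 1 E (- 3 * (bessel_clifford 1 y * bessel_clifford 1 y)).
  have D0 := is_derive_bc 0 y; have D1 := is_derive_bc 1 y.
  have DI : is_derive y 1 (fun s : R => s) 1 := is_derive_id y (1 : R).
  have h1 := is_derive_mul DI (is_derive_mul D1 D1).
  have h0 := is_derive_mul D0 D0.
  apply: is_derive_eq; rewrite /GRing.scale /=.
  have := bc_ode y; move: (bessel_clifford 0 y) (bessel_clifford 1 y) (bessel_clifford 2 y).
  move=> a b c o; have -> : a = - (y * c + 2 * b) by lra.
  by ring.
have : E x <= E 0.
  apply: (@ler0_derive1_nincry R E 0) => // [y _|].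
  - rewrite derive1E (@derive_val _ _ _ _ _ _ _ (DE y)) mulNr oppr_le0.
    by rewrite mulr_ge0// -expr2 sqr_ge0.
  - apply: derivable_within_continuous => y _.
    exact: (@ex_derive _ _ _ _ _ _ _ (DE y)).
rewrite /E mul0r add0r bc0 mulr1 => h.
rewrite -(@ler_pXn2r _ 2) ?nnegrE// expr1n real_normK ?num_real// expr2.
by apply: le_trans h; rewrite lerDr mulr_ge0// -expr2 sqr_ge0.
Qed.

Lemma kerKE s t : 0 < s -> 0 < t -> kerK t s = bessel_clifford 0 (s * t) :> R.
Proof.
move=> s0 t0; rewrite /kerK /besselJ /bessel_clifford.
set r := Num.sqrt (s * t).
have r0 : r != 0 by rewrite gt_eqF// sqrtr_gt0 mulr_gt0.
rewrite -[s * t]sqr_sqrtr ?mulr_ge0 ?ltW// -/r.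
(* At [x = 2 r] the halved argument is [r], so each partial sum of [J_1] is [r] times that of [g] at
   [r^2]; dividing by [r = sqrt (s t)] gives the kernel. *)
suff e : series (fun k : nat => (-1) ^+ k / (k`! * (k + 1)`!)%:R *
    (2 * r / 2) ^+ (2 * k + 1)%N) = (fun n => pseries (bc_coeff 0) (r ^+ 2) n * r).
  rewrite e limM//; [|exact: is_cvg_pseries_bc|exact: is_cvg_cst].
  by rewrite lim_cst// mulfK.
apply/funext => n; rewrite /pseries /series /= mulr_suml; apply: eq_bigr => k _.
rewrite /bc_coeff addn0 [2 * r]mulrC mulfK ?pnatr_eq0//.
by rewrite exprD expr1 -exprM mulrA.
Qed.

(* Each of the two factorials absorbs one of the powers [a ^ k], [b ^ k], so that
   the growth in [a] can be made slow by rescaling. *)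
Lemma norm_pseries_bc_le n (a b : R) : 0 <= a -> 0 <= b ->
  `|pseries (bc_coeff 0) (a * b) n| <= expR a * expR b.
Proof.
move=> a0 b0; apply: le_trans (ler_norm_sum _ _ _) _.
apply: (@le_trans _ _ (\sum_(0 <= k < n) expR a * (exp_coeff b k))).
  apply: ler_sum => k _ /=; rewrite normrM [X in _ * X]ger0_norm ?exprn_ge0 ?mulr_ge0//.
  rewrite /bc_coeff normrM normrX normrN1 expr1n mul1r ger0_norm ?invr_ge0//.
  rewrite natrM invfM exprMn mulrACA.
  apply: ler_pM; rewrite ?mulr_ge0 ?invr_ge0 ?exprn_ge0//.
    by rewrite mulrC exp_coeff_le_expR.
  rewrite /exp_coeff /= mulrC ler_wpM2l ?exprn_ge0// lef_pV2 ?posrE ?ltr0n ?fact_gt0//.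
  by rewrite ler_nat addn1 leq_fact.
rewrite -mulr_sumr ler_wpM2l ?expR_ge0//.
rewrite /expR; apply: nondecreasing_cvgn_le; last exact: is_cvg_series_exp_coeff.
by apply: nondecreasing_series => k _ _; exact: exp_coeff_ge0.
Qed.

End bessel_clifford.

(** * Componentwise integrals *)

Section complex_integral.
Local Open Scope ring_scope.
Context d (T : measurableType d) (R : realType).
Implicit Types (D : set T) (F G : T -> R[i]) (c : R[i]).

Definition cmeasurable D F : Prop :=
  measurable_fun D (fun x => complex.Re (F x)) /\
  measurable_fun D (fun x => complex.Im (F x)).

Lemma eq_cmeasurable D F G : (forall x, D x -> F x = G x) ->
  cmeasurable D F -> cmeasurable D G.
Proof.
by move=> FG [mr mi]; split; [apply: eq_measurable_fun mr|apply: eq_measurable_fun mi];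
  move=> x /set_mem Dx; rewrite /= FG.
Qed.

Lemma cmeasurableM D F G : cmeasurable D F -> cmeasurable D G ->
  cmeasurable D (fun x => F x * G x).
Proof.
move=> [fr fi] [gr gi]; split.
- under eq_fun do rewrite ReM.
  by apply: measurable_funB; apply: measurable_funM.
- under eq_fun do rewrite ImM.
  by apply: measurable_funD; apply: measurable_funM.
Qed.

Lemma cmeasurableR D (f : T -> R) : measurable_fun D f ->
  cmeasurable D (fun x => (f x)%:C).
Proof. by move=> mf; split => //=; exact: measurable_cst. Qed.

Lemma cmeasurable_cst D c : cmeasurable D (fun=> c).
Proof. by split; exact: measurable_cst. Qed.

Lemma cmeasurableZ D c F : cmeasurable D F -> cmeasurable D (fun x => c * F x).
Proof. exact/cmeasurableM/cmeasurable_cst. Qed.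

Lemma cmeasurable_sum D (I : Type) (r : seq I) (F : I -> T -> R[i]) :
  (forall i, cmeasurable D (F i)) ->
  cmeasurable D (fun x => \sum_(i <- r) F i x).
Proof.
move=> mF; split.
- under eq_fun do rewrite Re_sum.
  by apply: measurable_sum => i; have [] := mF i.
- under eq_fun do rewrite Im_sum.
  by apply: measurable_sum => i; have [] := mF i.
Qed.

Variable mu : {measure set T -> \bar R}.

Definition cint_on D F : R[i] :=
  (\int[mu]_(x in D) complex.Re (F x)) +i* (\int[mu]_(x in D) complex.Im (F x)).

Definition cintegrable_on D F : Prop :=
  mu.-integrable D (EFin \o (fun x => complex.Re (F x))) /\
  mu.-integrable D (EFin \o (fun x => complex.Im (F x))).

Lemma eq_cint D F G : (forall x, D x -> F x = G x) -> cint_on D F = cint_on D G.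
Proof.
by move=> FG; congr Complex; apply: eq_Rintegral => x /set_mem Dx; rewrite FG.
Qed.

Variables (D : set T) (mD : measurable D).

Lemma cintegrable_le F (g : T -> R) : cmeasurable D F ->
  (forall x, D x -> normc (F x) <= g x) ->
  mu.-integrable D (EFin \o g) -> cintegrable_on D F.
Proof.
move=> [mr mi] Fg ig; split; apply: le_integrable ig => //.
- exact/measurable_EFinP.
- move=> x Dx /=; rewrite lee_fin (le_trans (norm_Re_le _))//.
  by rewrite (le_trans (Fg _ Dx))// ler_norm.
- exact/measurable_EFinP.
- move=> x Dx /=; rewrite lee_fin (le_trans (norm_Im_le _))//.
  by rewrite (le_trans (Fg _ Dx))// ler_norm.
Qed.

Lemma cintegrable_cmeasurable F : cintegrable_on D F -> cmeasurable D F.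
Proof.
by move=> [/measurable_int/measurable_EFinP ? /measurable_int/measurable_EFinP].
Qed.

Lemma integrable_scale (a : R) (f : T -> R) : mu.-integrable D (EFin \o f) ->
  mu.-integrable D (EFin \o (fun x => a * f x)).
Proof. by move=> /(integrableZl mD a); exact: eq_integrable. Qed.

Lemma cintegrableZ c F : cintegrable_on D F -> cintegrable_on D (fun x => c * F x).
Proof.
move=> [fr fi]; split.
- apply: eq_integrable (integrableB mD (integrable_scale (complex.Re c) fr)
    (integrable_scale (complex.Im c) fi)) => // x _ /=.
  by rewrite ReM.
- apply: eq_integrable (integrableD mD (integrable_scale (complex.Re c) fi)
    (integrable_scale (complex.Im c) fr)) => // x _ /=.
  by rewrite ImM.
Qed.

Lemma cintZ c F : cintegrable_on D F ->
  cint_on D (fun x => c * F x) = c * cint_on D F.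
Proof.
move=> [fr fi]; apply: complex_eq => /=.
- under eq_Rintegral do rewrite ReM.
  rewrite RintegralB//; [|exact: integrable_scale|exact: integrable_scale].
  by rewrite !RintegralZl// ReM.
- under eq_Rintegral do rewrite ImM.
  rewrite RintegralD//; [|exact: integrable_scale|exact: integrable_scale].
  by rewrite !RintegralZl// ImM.
Qed.

Lemma cintegrableD F G : cintegrable_on D F -> cintegrable_on D G ->
  cintegrable_on D (fun x => F x + G x).
Proof.
move=> [fr fi] [gr gi]; split.
- by apply: eq_integrable (integrableD mD fr gr) => // x _ /=; rewrite ReD.
- by apply: eq_integrable (integrableD mD fi gi) => // x _ /=; rewrite ImD.
Qed.

Lemma cintD F G : cintegrable_on D F -> cintegrable_on D G ->
  cint_on D (fun x => F x + G x) = cint_on D F + cint_on D G.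
Proof.
move=> [fr fi] [gr gi]; apply: complex_eq => /=.
- by under eq_Rintegral do rewrite ReD; rewrite RintegralD.
- by under eq_Rintegral do rewrite ImD; rewrite RintegralD.
Qed.

Lemma cintB F G : cintegrable_on D F -> cintegrable_on D G ->
  cint_on D (fun x => F x - G x) = cint_on D F - cint_on D G.
Proof.
move=> iF iG; rewrite -[- cint_on D G]mulN1r -cintZ// -cintD//.
  by apply: eq_cint => x _; rewrite mulN1r.
exact: cintegrableZ.
Qed.

Lemma cint0 : cint_on D (fun=> 0) = 0.
Proof. by rewrite /cint_on /= /Rintegral integral0. Qed.

Lemma cintegrable0 : cintegrable_on D (fun=> 0).
Proof. by split; exact: integrable0. Qed.

Lemma cint_sum (I : Type) (r : seq I) (F : I -> T -> R[i]) :
  (forall i, cintegrable_on D (F i)) ->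
  cintegrable_on D (fun x => \sum_(i <- r) F i x) /\
  cint_on D (fun x => \sum_(i <- r) F i x) = \sum_(i <- r) cint_on D (F i).
Proof.
move=> iF; elim: r => [|i r [ih1 ih2]].
  under eq_fun do rewrite big_nil.
  by rewrite big_nil cint0; split=> //; exact: cintegrable0.
under eq_fun do rewrite big_cons.
rewrite big_cons -ih2; split; first exact: cintegrableD.
exact: cintD.
Qed.

Lemma Rintegral_dominated (f_ : nat -> T -> R) (f g : T -> R) :
  (forall n, measurable_fun D (f_ n)) -> measurable_fun D f ->
  (forall x, D x -> f_ ^~ x @ \oo --> f x) ->
  mu.-integrable D (EFin \o g) ->
  (forall n x, D x -> `|f_ n x| <= g x) ->
  (fun n => \int[mu]_(x in D) f_ n x) @ \oo --> \int[mu]_(x in D) f x.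
Proof.
move=> mf_ mf cf ig fg.
have [||||| if_ _ h] := @dominated_convergence _ _ _ mu D mD
  (fun n => EFin \o f_ n) (EFin \o f) (EFin \o g).
- by move=> n; exact/measurable_EFinP.
- exact/measurable_EFinP.
- by apply: aeW => x Dx /=; apply: cvg_EFin; [exact: nearW|exact: cf].
- exact: ig.
- by apply: aeW => x n Dx; rewrite /= lee_fin; exact: fg.
- apply: fine_cvg; rewrite fineK//; exact: integrable_fin_num.
Qed.

Lemma cint_dominated (F_ : nat -> T -> R[i]) F (g : T -> R) :
  (forall n, cmeasurable D (F_ n)) -> cmeasurable D F ->
  (forall x, D x -> ccvg (F_ ^~ x) (F x)) ->
  mu.-integrable D (EFin \o g) ->
  (forall n x, D x -> normc (F_ n x) <= g x) ->
  ccvg (fun n => cint_on D (F_ n)) (cint_on D F).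
Proof.
move=> mF_ mF cF ig Fg; split => /=; apply: Rintegral_dominated ig _.
- by move=> n; have [] := mF_ n.
- by have [] := mF.
- by move=> x /cF[].
- by move=> n x /(Fg n); apply: le_trans; exact: norm_Re_le.
- by move=> n; have [] := mF_ n.
- by have [] := mF.
- by move=> x /cF[].
- by move=> n x /(Fg n); apply: le_trans; exact: norm_Im_le.
Qed.

(** The factor 2 comes from bounding the two components separately. The estimate serves to bound
    [K phi] by some finite constant. *)
Lemma normc_cint F (g : T -> R) : cmeasurable D F ->
  (forall x, D x -> normc (F x) <= g x) ->
  mu.-integrable D (EFin \o g) ->
  normc (cint_on D F) <= 2 * \int[mu]_(x in D) g x.
Proof.
move=> mF Fg ig; have [fr fi] := cintegrable_le mF Fg ig.
rewrite (le_trans (normc_le_norm1 _))//= mulr2n mulrDl mul1r lerD//.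
- rewrite (le_trans (le_normr_Rintegral mD fr))// le_Rintegral//.
    exact: integrable_norm.
  by move=> x Dx; rewrite (le_trans (norm_Re_le _))// Fg.
- rewrite (le_trans (le_normr_Rintegral mD fi))// le_Rintegral//.
    exact: integrable_norm.
  by move=> x Dx; rewrite (le_trans (norm_Im_le _))// Fg.
Qed.

End complex_integral.

(** * Fubini's theorem on a product of measurable sets *)

Section fubini_on.
Context d1 d2 (T1 : measurableType d1) (T2 : measurableType d2) (R : realType).
Variable m1 : {sigma_finite_measure set T1 -> \bar R}.
Variable m2 : {sigma_finite_measure set T2 -> \bar R}.
Variables (D1 : set T1) (D2 : set T2).
Hypotheses (mD1 : measurable D1) (mD2 : measurable D2).

(** Extension by zero moves the integrals to the whole product space, where Tonelli and the product
    majorant give integrability. The measurability conclusion is kept because it later yields the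
    measurability of [K phi]. *)
Lemma Fubini_on (f : T1 * T2 -> R) (g1 : T1 -> R) (g2 : T2 -> R) :
  measurable_fun (D1 `*` D2) f ->
  (forall x y, D1 x -> D2 y -> `|f (x, y)| <= g1 x * g2 y) ->
  m1.-integrable D1 (EFin \o g1) -> m2.-integrable D2 (EFin \o g2) ->
  (forall x, D1 x -> 0 <= g1 x) -> (forall y, D2 y -> 0 <= g2 y) ->
  measurable_fun D1 (fun x => \int[m2]_(y in D2) f (x, y)) /\
  \int[m1]_(x in D1) (\int[m2]_(y in D2) f (x, y)) =
  \int[m2]_(y in D2) (\int[m1]_(x in D1) f (x, y)).
Proof.
move=> mf fg ig1 ig2 g10 g20.
have mD : measurable (D1 `*` D2) by exact: measurableX.
pose h : T1 * T2 -> \bar R := (EFin \o f) \_ (D1 `*` D2).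
have mh : measurable_fun setT h.
  by apply/(measurable_restrictT _ mD); exact/measurable_EFinP.
have hE x y : h (x, y) = if (x \in D1) && (y \in D2) then (f (x, y))%:E else 0%E.
  by rewrite /h patchE in_setX.
have ih : (m1 \x m2)%E.-integrable setT h.
  apply/integrable12ltyP => //.
  apply: (@le_lt_trans _ _ (\int[m1]_(x in D1) ((g1 x)%:E * \int[m2]_(y in D2) (g2 y)%:E))%E).
    rewrite [leRHS]integral_mkcond; apply: ge0_le_integral => //.
    - by move=> x _; exact: integral_ge0.
    - apply: (measurable_fun_fubini_tonelli_F (abse \o h)) => //.
        exact: measurableT_comp.
      by move=> ?; exact: abse_ge0.
    - apply/(measurable_restrictT _ mD1); apply: emeasurable_funM => //.
      exact: measurable_int ig1.
    - move=> x _; rewrite patchE; case: ifPn => [xD1|xD1].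
        rewrite -ge0_integralZl//; last 2 first.
        + exact: measurable_int ig2.
        + by rewrite lee_fin g10//; exact: set_mem.
        rewrite [leRHS]integral_mkcond; apply: ge0_le_integral => //.
        + by apply: measurableT_comp => //; exact: measurableT_comp.
        + apply/(measurable_restrictT _ mD2); apply: emeasurable_funM => //.
          exact: measurable_int ig2.
        + move=> y _; rewrite hE xD1 /= patchE; case: ifPn => yD2.
            by rewrite lee_fin fg//; exact: set_mem.
          by rewrite abse0.
      by rewrite integral0_eq// => y _; rewrite hE (negbTE xD1) abse0.
  rewrite ge0_integralZr//; last 2 first.
  - exact: measurable_int ig1.
  - by apply: integral_ge0 => y Dy; rewrite lee_fin g20.
  by rewrite lte_mul_pinfty ?integral_ge0 ?integrable_fin_num ?integrable_lty.
have hx x : fubini_F m2 h x = (if x \in D1 then \int[m2]_(y in D2) (f (x, y))%:E else 0)%E.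
  rewrite /fubini_F; case: ifPn => xD1.
    by rewrite [RHS]integral_mkcond; apply: eq_integral => y _; rewrite hE xD1 patchE.
  by rewrite integral0_eq// => y _; rewrite hE (negbTE xD1).
have hy y : (\int[m1]_x h (x, y) = if y \in D2 then \int[m1]_(x in D1) (f (x, y))%:E else 0)%E.
  case: ifPn => yD2.
    by rewrite [RHS]integral_mkcond; apply: eq_integral => x _; rewrite hE yD2 andbT patchE.
  by rewrite integral0_eq// => x _; rewrite hE (negbTE yD2) andbF.
(* A real integral is [fine] of an extended one, with a default value at infinity. Every inner
   integral is finite by the majorant, so that default never interferes with the exchange. *)
have fin1 x : D1 x -> (\int[m2]_(y in D2) (f (x, y))%:E)%E \is a fin_num.
  move=> Dx; apply: integrable_fin_num => //.
  apply: (@le_integrable _ _ _ _ _ mD2 _ (fun y => (g1 x * g2 y)%:E)).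
  - apply/measurable_EFinP; apply: (@measurable_comp _ _ _ _ _ _ (D1 `*` D2) f) => //.
    + by move=> _ [y Dy <-].
    + exact: measurable_funTS.
  - move=> y Dy /=; rewrite lee_fin (le_trans (fg _ _ Dx Dy))// ler_norm//.
  - exact: (integrable_scale mD2 (g1 x) ig2).
have fin2 y : D2 y -> (\int[m1]_(x in D1) (f (x, y))%:E)%E \is a fin_num.
  move=> Dy; apply: integrable_fin_num => //.
  apply: (@le_integrable _ _ _ _ _ mD1 _ (fun x => (g2 y * g1 x)%:E)).
  - apply/measurable_EFinP; apply: (@measurable_comp _ _ _ _ _ _ (D1 `*` D2) f) => //.
    + by move=> _ [x Dx <-].
    + exact: measurable_funTS.
  - by move=> x Dx /=; rewrite lee_fin mulrC (le_trans (fg _ _ Dx Dy))// ler_norm.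
  - exact: (integrable_scale mD1 (g2 y) ig1).
split.
  have := measurable_fubini_F ih; rewrite (funext hx) => mF.
  apply: (@eq_measurable_fun _ _ _ _ D1 (fun x =>
    fine (if x \in D1 then \int[m2]_(y in D2) (f (x, y))%:E else 0)%E)).
    by move=> x xD1; rewrite xD1.
  exact/measurable_funTS/measurableT_comp.
have := Fubini ih; rewrite -[X in X = _ -> _]/(\int[m1]_x fubini_F m2 h x)%E.
rewrite (funext hx) (funext hy) => e.
rewrite /Rintegral; congr fine.
transitivity (\int[m1]_x (if x \in D1 then \int[m2]_(y in D2) (f (x, y))%:E else 0))%E.
  rewrite [LHS]integral_mkcond; apply: eq_integral => x _; rewrite patchE.
  by case: ifPn => // /set_mem Dx; rewrite fineK// fin1.
rewrite e [RHS]integral_mkcond; apply: eq_integral => y _; rewrite patchE.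
by case: ifPn => // /set_mem Dy; rewrite fineK// fin2.
Qed.

Lemma cFubini_on (F : T1 * T2 -> R[i]) (g1 : T1 -> R) (g2 : T2 -> R) :
  cmeasurable (D1 `*` D2) F ->
  (forall x y, D1 x -> D2 y -> normc (F (x, y)) <= g1 x * g2 y) ->
  m1.-integrable D1 (EFin \o g1) -> m2.-integrable D2 (EFin \o g2) ->
  (forall x, D1 x -> 0 <= g1 x) -> (forall y, D2 y -> 0 <= g2 y) ->
  cmeasurable D1 (fun x => cint_on m2 D2 (fun y => F (x, y))) /\
  cint_on m1 D1 (fun x => cint_on m2 D2 (fun y => F (x, y))) =
  cint_on m2 D2 (fun y => cint_on m1 D1 (fun x => F (x, y))).
Proof.
move=> [mr mi] Fg ig1 ig2 g10 g20.
have [|r1 r2] := Fubini_on mr _ ig1 ig2 g10 g20.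
  by move=> x y Dx Dy; rewrite (le_trans (norm_Re_le _))// Fg.
have [|i1 i2] := Fubini_on mi _ ig1 ig2 g10 g20.
  by move=> x y Dx Dy; rewrite (le_trans (norm_Im_le _))// Fg.
by split => //; congr Complex.
Qed.

End fubini_on.

(** * Exponential moments *)

Section exponential_integrals.
Context {R : realType}.
Local Notation lam := (@lebesgue_measure R).
Implicit Types (F f : R -> R) (c C t : R).

Lemma RposE t : Rpos t = (0 < t).
Proof. by rewrite /Rpos /= in_itv /= andbT. Qed.

Let mRpos : measurable (Rpos : set (measurableTypeR R)).
Proof. exact: measurable_Rpos. Qed.

Lemma cvg_expRNM c : 0 < c -> expR (- (c * t)) @[t --> +oo] --> (0 : R).
Proof.
move=> c0; apply: (@cvg_comp _ _ _ (fun t => c * t) (fun t => expR (- t)) +oo +oo);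
  last exact: cvgr_expR.
by apply: gt0_cvgMry => //; exact: cvg_cst.
Qed.

Lemma ge0_FTC_Rpos F f (l : R) : (forall t, 0 <= t -> 0 <= f t) ->
  continuous f -> (forall t : R, is_derive t 1 F (f t)) ->
  F t @[t --> +oo] --> l ->
  (\int[lam]_(t in Rpos) (f t)%:E = (l - F 0)%:E)%E.
Proof.
move=> f0 cf DF Fl.
have mf : measurable_fun Rpos f.
  by apply: measurable_funTS; exact: continuous_measurable_fun.
rewrite /Rpos integral_itv_obnd_cbnd; last exact/measurable_EFinP.
rewrite (@ge0_continuous_FTC2y _ f F 0 l)//.
- exact: continuous_subspaceT.
- apply: cvg_at_right_filter; apply: differentiable_continuous.
  by apply/derivable1_diffP; exact: (@ex_derive _ _ _ _ _ _ _ (DF 0)).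
- by move=> t _; rewrite derive1E (@derive_val _ _ _ _ _ _ _ (DF t)).
Qed.

Lemma is_derive_expRNM c t :
  is_derive t 1 (fun s => - c^-1 * expR (- (c * s))) (- c^-1 * (- c * expR (- (c * t)))).
Proof.
apply: is_derive_eq; rewrite /GRing.scale /= ?mulr1; ring.
Qed.

Lemma continuous_expRNM c : continuous (fun t : R => expR (- (c * t))).
Proof.
move=> t; apply: (@cvg_comp _ _ _ (fun s => - (c * s)) expR); last exact: continuous_expR.
by apply: cvgN; apply: cvgM; [exact: cvg_cst|exact: cvg_id].
Qed.

Lemma integral_expRNM c : 0 < c ->
  (\int[lam]_(t in Rpos) (expR (- (c * t)))%:E = (c^-1)%:E)%E.
Proof.
move=> c0.
have DF t : is_derive t 1 (fun s => - c^-1 * expR (- (c * s))) (expR (- (c * t))).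
  have := is_derive_expRNM c t.
  by rewrite mulrA mulrNN mulVf ?mul1r ?gt_eqF.
have Fl : (fun s => - c^-1 * expR (- (c * s))) t @[t --> +oo] --> 0.
  rewrite -[X in _ --> X](mulr0 (- c^-1)).
  by apply: cvgM; [exact: cvg_cst|exact: cvg_expRNM].
rewrite (ge0_FTC_Rpos _ _ DF Fl).
- by rewrite mulr0 oppr0 expR0 mulr1 sub0r opprK.
- by move=> t _; exact: expR_ge0.
- exact: continuous_expRNM.
Qed.

Lemma integrable_expRNM c : 0 < c ->
  lam.-integrable Rpos (EFin \o (fun t => expR (- (c * t)))).
Proof.
move=> c0; apply/integrableP; split.
  apply/measurable_EFinP; apply: measurable_funTS.
  by apply: continuous_measurable_fun; exact: continuous_expRNM.
under eq_integral do rewrite /= ger0_norm ?expR_ge0//.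
by rewrite integral_expRNM// ltry.
Qed.

(** Adding the majorant makes the integrand nonnegative, which reduces a signed [f] to
    [ge0_FTC_Rpos]; the integral of the majorant is then subtracted. *)
Lemma FTC_Rpos F f C c : 0 < c -> continuous f ->
  (forall t : R, is_derive t 1 F (f t)) ->
  (forall t, 0 <= t -> `|f t| <= C * expR (- (c * t))) ->
  F t @[t --> +oo] --> 0 ->
  \int[lam]_(t in Rpos) f t = - F 0.
Proof.
move=> c0 cf DF fC F0.
pose g t := C * expR (- (c * t)).
have ig : lam.-integrable Rpos (EFin \o g).
  exact: (integrable_scale mRpos C (integrable_expRNM c0)).
have intf : lam.-integrable Rpos (EFin \o f).
  apply: le_integrable ig => //.
    by apply/measurable_EFinP; apply: measurable_funTS; exact: continuous_measurable_fun.
  by move=> t; rewrite RposE => t0; rewrite lee_fin (le_trans (fC _ (ltW t0)))// ler_norm.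
(* A primitive of [f + g] that vanishes at infinity, so its integral is [- H 0 = C / c - F 0]. *)
pose H s := F s + C * (- c^-1 * expR (- (c * s))).
have DH t : is_derive t 1 H (f t + g t).
  have h0 := DF t; have h1 := is_derive_expRNM c t.
  apply: is_derive_eq; rewrite /GRing.scale /= /g.
  by field; rewrite gt_eqF.
have Hl : H t @[t --> +oo] --> 0.
  rewrite -[X in _ --> X](addr0 0); apply: cvgD => //.
  rewrite -[X in _ --> X](mulr0 C); apply: cvgM; first exact: cvg_cst.
  rewrite -[X in _ --> X](mulr0 (- c^-1)).
  by apply: cvgM; [exact: cvg_cst|exact: cvg_expRNM].
have h : \int[lam]_(t in Rpos) (f t + g t) = C / c - F 0.
  rewrite /Rintegral (ge0_FTC_Rpos _ _ DH Hl)/=.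
  - by rewrite /H mulr0 oppr0 expR0; ring.
  - by move=> t t0; rewrite -lerBlDr sub0r; have := fC t t0; rewrite ler_norml => /andP[].
  - move=> t; apply: cvgD; first exact: cf.
    by apply: cvgM; [exact: cvg_cst|exact: continuous_expRNM].
move: h; rewrite RintegralD//.
have -> : \int[lam]_(t in Rpos) g t = C / c.
  rewrite RintegralZl//; last exact: integrable_expRNM.
  by rewrite /Rintegral integral_expRNM.
lra.
Qed.

Lemma pow_expR_le n c t : 0 < c -> 0 <= t ->
  t ^+ n <= n`!%:R * c^-1 ^+ n * expR (c * t).
Proof.
move=> c0 t0; have := @exp_coeff_le_expR R (c * t) n (mulr_ge0 (ltW c0) t0).
rewrite ler_pdivrMr ?ltr0n ?fact_gt0// exprMn -ler_pdivlMl ?exprn_gt0// exprVn.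
by move=> h; apply: le_trans h _; rewrite le_eqVlt; apply/orP; left; apply/eqP; ring.
Qed.

(** The second derivative [f'] supplies the continuity of [f], and the bound on [F] supplies the
    limit 0 at infinity. *)
Lemma cFTC_Rpos (F f f' : R -> R[i]) C c C' c' : 0 < c -> 0 < c' ->
  (forall t, cderive F t (f t)) -> (forall t, cderive f t (f' t)) ->
  (forall t, 0 <= t -> normc (f t) <= C * expR (- (c * t))) ->
  (forall t, 0 <= t -> normc (F t) <= C' * expR (- (c' * t))) ->
  cint_on lam Rpos f = - F 0.
Proof.
move=> c0 c'0 DF Df fC FC.
have FC0 : (fun t => C' * expR (- (c' * t))) t @[t --> +oo] --> 0.
  rewrite -[X in _ --> X](mulr0 C').
  by apply: cvgM; [exact: cvg_cst|exact: cvg_expRNM].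
have cvg0 (G : R -> R) : (forall t, `|G t| <= normc (F t)) -> G t @[t --> +oo] --> 0.
  move=> GF; apply/cvgrPdist_le => e e0.
  have /cvgrPdist_le/(_ _ e0) := FC0.
  apply: filter_app; near=> t => h; rewrite sub0r normrN.
  apply: le_trans (GF t) (le_trans (FC t _) _).
    by near: t; apply: nbhs_pinfty_ge; rewrite num_real.
  by apply: le_trans h; rewrite sub0r normrN ler_norm.
have cont (G G' : R -> R) : (forall t : R, is_derive t 1 G (G' t)) -> continuous G.
  move=> h t; apply: differentiable_continuous; apply/derivable1_diffP.
  exact: (@ex_derive _ _ _ _ _ _ _ (h t)).
apply: complex_eq => /=.
- have DFp t : is_derive t 1 (fun s => complex.Re (F s)) (complex.Re (f t)).
    by have [] := DF t.
  have Dfp t : is_derive t 1 (fun s => complex.Re (f s)) (complex.Re (f' t)).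
    by have [] := Df t.
  rewrite (FTC_Rpos c0 (cont _ _ Dfp) DFp (C := C)).
  + by case: (F 0).
  + by move=> t t0; rewrite (le_trans (norm_Re_le _))// fC.
  + by apply: cvg0 => t; exact: norm_Re_le.
- have DFp t : is_derive t 1 (fun s => complex.Im (F s)) (complex.Im (f t)).
    by have [] := DF t.
  have Dfp t : is_derive t 1 (fun s => complex.Im (f s)) (complex.Im (f' t)).
    by have [] := Df t.
  rewrite (FTC_Rpos c0 (cont _ _ Dfp) DFp (C := C)).
  + by case: (F 0).
  + by move=> t t0; rewrite (le_trans (norm_Im_le _))// fC.
  + by apply: cvg0 => t; exact: norm_Im_le.
Unshelve. all: by end_near. Qed.

Lemma cmeasurable_derivable (D : set (measurableTypeR R)) (f f' : R -> R[i]) :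
  measurable D -> (forall t, cderive f t (f' t)) -> cmeasurable D f.
Proof.
move=> mD Df; split; apply: measurable_funTS; apply: continuous_measurable_fun => t;
  apply: differentiable_continuous; apply/derivable1_diffP;
  have [h1 h2] := Df t.
- exact: (@ex_derive _ _ _ _ _ _ _ h1).
- exact: (@ex_derive _ _ _ _ _ _ _ h2).
Qed.

Variable u : R[i].
Hypothesis u0 : 0 < complex.Re u.

Definition pow_exp n t : R[i] := (t ^+ n)%:C * expC (- (t%:C * u)).

Lemma normc_pow_exp n t : 0 <= t ->
  normc (pow_exp n t) = t ^+ n * expR (- (complex.Re u * t)).
Proof.
move=> t0; rewrite /pow_exp normcM normcR normc_expC ger0_norm ?exprn_ge0//.
by congr (_ * expR _); case: (u) => a b /=; ring.
Qed.

(** The decay is split into two equal halves: one absorbs [t^n] through the exponential series, the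
    other remains. *)
Lemma normc_pow_exp_le n t : 0 <= t -> normc (pow_exp n t) <=
  n`!%:R * (complex.Re u / 2)^-1 ^+ n * expR (- (complex.Re u / 2 * t)).
Proof.
move=> t0; rewrite normc_pow_exp//; set a := complex.Re u.
have h : expR (- (a * t)) = expR (- (a / 2 * t)) * expR (- (a / 2 * t)).
  by rewrite -expRD; congr expR; field.
rewrite h mulrA ler_wpM2r ?expR_ge0// -ler_pdivlMr ?expR_gt0// -expRN opprK.
by rewrite pow_expR_le// divr_gt0.
Qed.

Lemma cderive_pow_exp n t : cderive (pow_exp n) t
  (n%:R * pow_exp n.-1 t - u * pow_exp n t).
Proof.
have := cderiveM (cderive_pow n t) (cderive_expC (- u) t).
rewrite (_ : (fun s => _) = pow_exp n); last first.
  by apply/funext => s; rewrite mulrN.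
by congr cderive; rewrite /pow_exp !mulrN realcM realc_nat; ring.
Qed.

Lemma cintegrable_pow_exp n : cintegrable_on lam Rpos (pow_exp n).
Proof.
apply: (cintegrable_le mRpos (g := fun t =>
   n`!%:R * (complex.Re u / 2)^-1 ^+ n * expR (- (complex.Re u / 2 * t)))).
- by apply: cmeasurable_derivable (cderive_pow_exp n); exact: mRpos.
- by move=> t; rewrite RposE => /ltW; exact: normc_pow_exp_le.
- apply: (integrable_scale mRpos _ (integrable_expRNM _)).
  by rewrite divr_gt0.
Qed.

(** For complex [u] the substitution [tu -> t] would rotate the contour. Integrating the derivative
    of [t^k e^(-tu)] instead relates the moments [I_k] by [k I_(k-1) - u I_k = - 0^k]. *)
Lemma cint_pow_exp n : cint_on lam Rpos (pow_exp n) = n`!%:R / u ^+ n.+1.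
Proof.
have un0 : u != 0 by apply: contraTneq u0 => ->; rewrite /= ltxx.
have a20 : 0 < complex.Re u / 2 by rewrite divr_gt0.
pose K k : R := k`!%:R * (complex.Re u / 2)^-1 ^+ k.
(* At [k = 0] the predecessor is again 0, but its coefficient vanishes, so this case directly gives
   [I_0 = 1 / u]. *)
have step k : k%:R * cint_on lam Rpos (pow_exp k.-1) - u * cint_on lam Rpos (pow_exp k)
   = - pow_exp k 0.
  have ik j (c : R[i]) : cintegrable_on lam Rpos (fun t => c * pow_exp j t).
    by apply: (cintegrableZ mRpos); exact: cintegrable_pow_exp.
  rewrite -(cintZ mRpos k%:R (cintegrable_pow_exp _)).
  rewrite -(cintZ mRpos u (cintegrable_pow_exp _)) -(cintB mRpos (ik _ _) (ik _ _)).
  apply: (@cFTC_Rpos (pow_exp k) _ (fun t =>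
     k%:R * ((k.-1)%:R * pow_exp k.-2 t - u * pow_exp k.-1 t) +
     - u * (k%:R * pow_exp k.-1 t - u * pow_exp k t))
    (k%:R * K k.-1 + normc u * K k) (complex.Re u / 2) (K k) (complex.Re u / 2)) => //.
  - exact: cderive_pow_exp.
  - move=> t.
    have := cderiveD (cderiveZ k%:R (cderive_pow_exp k.-1 t))
      (cderiveZ (- u) (cderive_pow_exp k t)).
    by congr cderive; apply/funext => s; rewrite mulNr.
  - move=> t t0; rewrite (le_trans (normcD_le _ _))// normc_opp.
    rewrite (normcM k%:R) (normcM u) normc_nat.
    set e := expR _; rewrite [leRHS](_ : _ = k%:R * (K k.-1 * e) + normc u * (K k * e)).
      apply: lerD; apply: ler_wpM2l; rewrite ?ler0n ?normc_ge0//;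
        exact: normc_pow_exp_le.
    by ring.
  - by move=> t t0; exact: normc_pow_exp_le.
elim: n => [|n IH].
  have := step 0; rewrite mul0r sub0r /pow_exp expr0 mul0r oppr0 expC0 mulr1.
  by move=> /oppr_inj h; apply: (mulfI un0); rewrite h expr1 fact0 mul1r divff.
have := step n.+1; rewrite /= IH.
have -> : pow_exp n.+1 0 = 0 by rewrite /pow_exp expr0n mul0r.
rewrite oppr0 => /eqP; rewrite subr_eq0 => /eqP h.
apply: (mulfI un0); rewrite -h factS natrM [u ^+ n.+2]exprS invfM.
by rewrite [RHS]mulrCA mulVKf// mulrA.
Qed.

End exponential_integrals.

(** * The measure m *)

Section density_measure.
Context {R : realType}.
Local Notation lam := (@lebesgue_measure R).
Implicit Types (f : R -> R) (t : R).

Let mRpos : measurable (Rpos : set (measurableTypeR R)).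
Proof. exact: measurable_Rpos. Qed.

(** Here [e^(-t/2) (e^t - 1) = e^(t/2) - e^(-t/2) >= (1 + t/2) - 1]. The rate 1/2 is the one that
    matches the half-plane: it makes [e^(-tw) dm/dt] integrable for [Re w > -1/2]. *)
Lemma m_density_le t : 0 < t -> m_density t <= 2 * expR (- (2^-1 * t)).
Proof.
move=> t0; rewrite /m_density.
have e0 : 0 < expR t - 1 by rewrite subr_gt0 expR_gt1.
rewrite ler_pdivrMr//.
have h1 := expR_ge1Dx (2^-1 * t).
have h2 : expR (- (2^-1 * t)) <= 1 by rewrite -expR0 ler_expR oppr_le0 mulr_ge0// ltW.
have h3 : expR (- (2^-1 * t)) * (expR t - 1) = expR (2^-1 * t) - expR (- (2^-1 * t)).
  by rewrite mulrBr mulr1 -expRD; congr (expR _ - _); field.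
by rewrite -mulrA h3; lra.
Qed.

Import HBNNSimple.

(** On indicators the identity is the definition of [m]; linearity extends it to simple functions,
    and monotone convergence on both sides to all nonnegative measurable functions. *)
Lemma ge0_integral_m (f : R -> \bar R) : measurable_fun Rpos f ->
  (forall t, Rpos t -> 0 <= f t)%E ->
  (\int[m]_(t in Rpos) f t = \int[lam]_(t in Rpos) (f t * (m_density t)%:E))%E.
Proof.
move=> mf f0; have mP := @measurable_Rpos R.
have mdens : measurable_fun Rpos (EFin \o @m_density R).
  by apply/measurable_EFinP; exact: measurable_m_density.
pose h := nnsfun_approx mP mf.
have hf t : Rpos t -> (EFin \o h n) t @[n --> \oo] --> f t.
  by move=> Dt; exact: cvg_nnsfun_approx.
have hnd x a b : (a <= b)%N -> h a x <= h b x.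
  by move=> ab; have /lefP := nd_nnsfun_approx mP mf ab; exact.
have mh n D : measurable_fun D (EFin \o h n).
  by apply/measurable_EFinP; exact: measurable_funTS.
have -> : (\int[m]_(t in Rpos) f t =
    limn (fun n => \int[m]_(t in Rpos) (EFin \o h n) t))%E.
  under eq_integral => t /[!inE] Dt do rewrite -(cvg_lim _ (hf t Dt))//.
  apply: monotone_convergence => //.
  - by move=> n x Dx /=; rewrite lee_fin.
  - by move=> x Dx a b ab; rewrite lee_fin; exact: hnd.
have -> : (\int[lam]_(t in Rpos) (f t * (m_density t)%:E) =
    limn (fun n => \int[lam]_(t in Rpos) ((EFin \o h n) t * (m_density t)%:E)))%E.
  have fg t : Rpos t ->
      limn (fun n => ((EFin \o h n) t * (m_density t)%:E)%E) = (f t * (m_density t)%:E)%E.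
    by move=> Dt; apply/cvg_lim => //; apply: cvgeZr => //; exact: hf.
  under eq_integral => t /[!inE] Dt do rewrite -fg//.
  apply: monotone_convergence => //.
  - by move=> n; apply: emeasurable_funM; [exact: mh|exact: mdens].
  - by move=> n x Dx /=; rewrite mule_ge0 ?lee_fin ?m_density_ge0.
  - move=> x Dx a b ab; rewrite lee_wpmul2r ?lee_fin ?m_density_ge0//.
    exact: hnd.
congr (limn _); apply/funext => n.
have indich D r : measurable_fun D (fun x => (r * \1_(h n @^-1` [set r]) x)%:E).
  by apply/measurable_EFinP; apply: measurable_funM.
transitivity (\int[m]_(t in Rpos)
   (\sum_(y \in range (h n)) (y * \1_(h n @^-1` [set y]) t)%:E))%E.
  by apply: eq_integral => t tE; rewrite /= fimfunE -fsumEFin.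
rewrite ge0_integral_fsum//; last by move=> r t Dt; exact: nnfun_muleindic_ge0.
transitivity (\int[lam]_(t in Rpos) (\sum_(y \in range (h n))
    (y * \1_(h n @^-1` [set y]) t)%:E * (m_density t)%:E))%E; last first.
  apply: eq_integral => t tE.
  rewrite -ge0_mule_fsuml => [|y]; last exact: nnfun_muleindic_ge0.
  by rewrite /= {1}fimfunE -fsumEFin.
rewrite ge0_integral_fsum//; last 2 first.
  - by move=> y; apply: emeasurable_funM; [exact: indich|exact: mdens].
  - move=> y t Dt; rewrite mule_ge0 ?nnfun_muleindic_ge0// lee_fin.
    exact: m_density_ge0.
apply: eq_fsbigr => r; rewrite inE => -[t0 _ rt].
have r0 : (0 <= r)%R by rewrite -rt.
have mA : measurable (h n @^-1` [set r]) by [].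
under eq_integral do rewrite EFinM.
rewrite ge0_integralZl//; last first.
  by apply/measurable_EFinP; exact: measurable_indic.
rewrite integral_indic//.
under [RHS]eq_integral do rewrite EFinM -muleA.
rewrite [RHS]ge0_integralZl//; last 2 first.
- apply: emeasurable_funM; last exact: mdens.
  by apply/measurable_EFinP; exact: measurable_indic.
- by move=> t Dt; rewrite mule_ge0// lee_fin ?m_density_ge0.
congr (_ * _)%E.
transitivity (\int[lam]_(t in Rpos)
    ((EFin \o @m_density R) \_ (h n @^-1` [set r])) t)%E.
  rewrite -integral_mkcondr.
  transitivity (\int[lam]_(t in (h n @^-1` [set r] `&` Rpos) `&` Rpos)
    (m_density t)%:E)%E; first by [].
  by rewrite -setIA setIid setIC.
by apply: eq_integral => t _; rewrite muleC epatch_indic.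
Qed.

(** Multiplication by the nonnegative density commutes with positive and negative parts, so both
    sides are the same difference of extended integrals. *)
Lemma Rintegral_m f : measurable_fun Rpos f ->
  \int[m]_(t in Rpos) f t = \int[lam]_(t in Rpos) (f t * m_density t).
Proof.
move=> mf; rewrite /Rintegral; congr fine.
have mEf : measurable_fun Rpos (EFin \o f) by exact/measurable_EFinP.
rewrite integralE [RHS]integralE; congr (_ - _)%E.
- rewrite ge0_integral_m//; last exact: measurable_funepos.
  apply: eq_integral => t /set_mem Dt; rewrite !funeposE /= EFinM.
  by rewrite maxeMl ?mul0e// lee_fin m_density_ge0.
- rewrite ge0_integral_m//; last exact: measurable_funeneg.
  apply: eq_integral => t /set_mem Dt; rewrite !funenegE /= -mulNr EFinM.
  by rewrite maxeMl ?mul0e// lee_fin m_density_ge0.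
Qed.

(** Finiteness makes constants integrable, places bounded measurable functions in [L2m], and
    provides the sigma-finiteness required by Fubini. *)
Lemma m_finite : (m [set: R] < +oo)%E.
Proof.
have : lam.-integrable Rpos (EFin \o (@m_density R)).
  apply: (le_integrable mRpos _ _ (integrable_scale mRpos 2 (integrable_expRNM _))).
  - by apply/measurable_EFinP; exact: measurable_m_density.
  - move=> t /[dup] Dt; rewrite RposE => t0 /=; rewrite lee_fin.
    rewrite [leLHS]ger0_norm ?m_density_ge0//.
    exact: le_trans (m_density_le t0) (ler_norm _).
  - by rewrite invr_gt0.
move=> /integrableP[_]; rewrite /m setTI; apply: le_lt_trans.
apply: ge0_le_integral => //.
- by move=> t Dt; rewrite lee_fin m_density_ge0.
- by apply/measurable_EFinP; exact: measurable_m_density.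
- apply: measurableT_comp => //.
  by apply/measurable_EFinP; exact: measurable_m_density.
- by move=> t Dt; rewrite /= lee_fin ler_norm.
Qed.

HB.instance Definition _ := @Measure_isFinite.Build _ _ R (@m R) 
  (lty_fin_num_fun m_finite).

End density_measure.

(** * The Laplace transform of the kernel *)

Section laplace_kernel.
Context {R : realType}.
Local Notation lam := (@lebesgue_measure R).
Implicit Types (phi : R -> R[i]) (s t : R) (u w z : R[i]).

Let mRpos : measurable (Rpos : set (measurableTypeR R)).
Proof. exact: measurable_Rpos. Qed.

Lemma laplace_bessel_clifford u s : 0 < complex.Re u -> 0 < s ->
  cint_on lam Rpos (fun t => pow_exp u 1 t * (bessel_clifford 0 (s * t))%:C) =
  u^-1 ^+ 2 * expC (- (s%:C * u^-1)).
Proof.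
move=> u0 s0; set a := complex.Re u.
have un0 : u != 0 by apply: contraTneq u0 => ->; rewrite /= ltxx.
pose S n t := pseries (bc_coeff 0) (s * t) n.
pose F n t := pow_exp u 1 t * (S n t)%:C.
pose P k t : R[i] := (bc_coeff 0 k * s ^+ k)%:C * pow_exp u k.+1 t.
have FE n t : F n t = \sum_(0 <= k < n) P k t.
  rewrite /F /S /pseries /series /= realc_sum mulr_sumr.
  apply: eq_bigr => k _; rewrite /P /pow_exp expr1 exprMn exprS !realcM; ring.
have iP k : cintegrable_on lam Rpos (P k).
  by apply: (cintegrableZ mRpos); exact: cintegrable_pow_exp.
have cF n : cint_on lam Rpos (F n) = u^-1 ^+ 2 * expC_partial (- (s%:C * u^-1)) n.
  rewrite (eq_cint lam (fun t _ => FE n t)).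
  have [_ ->] := cint_sum mRpos (index_iota 0 n) iP.
  rewrite /expC_partial mulr_sumr; apply: eq_bigr => k _.
  (* The moment [(k+1)! / u^(k+2)] cancels the factor [(k+1)!] of the coefficient, leaving [u^(-2)]
     times the [k]-th Taylor term of [exp (- s/u)]. *)
  rewrite (cintZ mRpos _ (cintegrable_pow_exp u0 _)) cint_pow_exp// /bc_coeff addn0 addn1.
  rewrite -mulrN exprMn natrM invfM !realcM !realcX !realcV !realc_nat.
  have h1 : (k`!%:R : R[i]) != 0 by rewrite pnatr_eq0 -lt0n fact_gt0.
  have h2 : ((k.+1)`!%:R : R[i]) != 0 by rewrite pnatr_eq0 -lt0n fact_gt0.
  rewrite -[- u^-1]mulN1r [(-1 * _) ^+ k]exprMn !exprVn !exprS.
  have -> : (-1 : R)%:C = -1 by rewrite rmorphN rmorph1.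
  by field; rewrite h1 h2 un0 expf_neq0.
have a4 : 0 < a / 4 by rewrite divr_gt0.
apply: (@ccvg_unique _ (fun n => cint_on lam Rpos (F n))); last first.
  have -> : (fun n => cint_on lam Rpos (F n)) =
      (fun n => u^-1 ^+ 2 * expC_partial (- (s%:C * u^-1)) n) by exact/funext.
  by apply: ccvgM; [exact: ccvg_cst|exact: expC_series].
apply: (cint_dominated mRpos (g := fun t =>
   1`!%:R * (a / 2)^-1 ^+ 1 * expR (s / (a / 4)) * expR (- (a / 4 * t)))).
- move=> n; apply: (@eq_cmeasurable _ _ _ _ (fun t => \sum_(0 <= k < n) P k t)).
    by move=> t _; rewrite FE.
  by apply: cmeasurable_sum => k; exact: (cintegrable_cmeasurable (iP k)).
- apply: cmeasurableM.
    exact: (cintegrable_cmeasurable (cintegrable_pow_exp u0 _)).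
  apply: cmeasurableR; apply: measurable_funTS; apply: continuous_measurable_fun => t.
  apply: (@continuous_comp _ _ _ (fun t => s * t) (bessel_clifford 0)).
    by apply: cvgM; [exact: cvg_cst|exact: cvg_id].
  exact: continuous_bc.
- move=> t Dt; apply: ccvgM; first exact: ccvg_cst.
  by split => /=; [exact: is_cvg_pseries_bc|exact: cvg_cst].
- exact: (integrable_scale mRpos _ (integrable_expRNM a4)).
- move=> n t; rewrite RposE => t0; rewrite /F normcM normcR.
  have t0' := ltW t0; have h1 := normc_pow_exp_le u0 1 t0'.
  (* The argument [s t] is split so that the growth [e^(a t/4)] uses only half of the decay
     [e^(-a t/2)] of the weight; the other factor is constant in [t]. *)
  have h2 : `|S n t| <= expR (s / (a / 4)) * expR (a / 4 * t).
    rewrite /S (_ : s * t = s / (a / 4) * (a / 4 * t)); last first.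
      by field; rewrite gt_eqF.
    by apply: norm_pseries_bc_le; rewrite mulr_ge0 ?invr_ge0// ltW.
  have h3 : expR (- (a / 4 * t)) = expR (- (a / 2 * t)) * expR (a / 4 * t).
    by rewrite -expRD; congr expR; field.
  rewrite h3; apply: le_trans (ler_pM _ _ h1 h2) _; rewrite ?normc_ge0//.
  by rewrite le_eqVlt; apply/orP; left; apply/eqP; rewrite -/a; ring.
Qed.

(** An integrable pointwise majorant of [|phi|], obtained from [x <= 1 + x^2] in place of the
    Cauchy-Schwarz inequality. *)
Definition L2_bound phi s : R :=
  1 + (complex.Re (phi s) ^+ 2 + complex.Im (phi s) ^+ 2).

Lemma normc_le_L2_bound phi s : normc (phi s) <= L2_bound phi s.
Proof.
rewrite /L2_bound -normc_sqr; move: (normc_ge0 (phi s)); nra.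
Qed.

Lemma L2_bound_ge0 phi s : 0 <= L2_bound phi s.
Proof. by apply: le_trans (normc_le_L2_bound phi s); exact: normc_ge0. Qed.

Lemma L2m_cmeasurable phi : L2m phi -> cmeasurable Rpos phi.
Proof. by move=> []. Qed.

Lemma L2m_integrable phi : L2m phi -> m.-integrable Rpos (EFin \o L2_bound phi).
Proof.
move=> [mr mi h]; have mP := @measurable_Rpos R.
have i2 : m.-integrable Rpos
    (EFin \o (fun t => complex.Re (phi t) ^+ 2 + complex.Im (phi t) ^+ 2)).
  apply/integrableP; split.
    by apply/measurable_EFinP; apply: measurable_funD; exact: measurable_funX.
  apply: le_lt_trans h; apply: ge0_le_integral => //.
  - apply: measurableT_comp => //.
    by apply/measurable_EFinP; apply: measurable_funD; exact: measurable_funX.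
  - under eq_fun do rewrite normc_sqr.
    by apply/measurable_EFinP; apply: measurable_funD; exact: measurable_funX.
  - by move=> t Dt; rewrite /= lee_fin normc_sqr ger0_norm// addr_ge0 ?sqr_ge0.
have i1 : m.-integrable Rpos (EFin \o cst (1 : R)).
  exact: finite_measure_integrable_cst.
exact: (integrableD mP i1 i2).
Qed.

Lemma L2m_bounded phi (C : R) : cmeasurable Rpos phi ->
  (forall t, Rpos t -> normc (phi t) <= C) -> L2m phi.
Proof.
move=> [mr mi] hC; have mP := @measurable_Rpos R; split => //.
have i1 : m.-integrable Rpos (EFin \o cst (C ^+ 2)).
  exact: finite_measure_integrable_cst.
apply: le_lt_trans (integrable_lty mP i1); apply: ge0_le_integral => //.
- by move=> t _; rewrite lee_fin sqr_ge0.
- under eq_fun do rewrite normc_sqr.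
  by apply/measurable_EFinP; apply: measurable_funD; exact: measurable_funX.
- exact: measurable_int i1.
- move=> t Dt; rewrite /= lee_fin; have := hC t Dt.
  by have := normc_ge0 (phi t); nra.
Qed.

Lemma L2m_opM phi : L2m phi -> L2m (opM phi).
Proof.
move=> h; have [mr mi hi] := h; have mP := @measurable_Rpos R.
have [mr' mi'] : cmeasurable Rpos (opM phi).
  apply: cmeasurableM; last exact: L2m_cmeasurable.
  apply: cmeasurableR; apply: measurable_funTS.
  apply: (measurableT_comp (@measurable_expR R)); exact: oppr_measurable.
split => //; apply: le_lt_trans hi; apply: ge0_le_integral => //.
- by move=> t _; rewrite lee_fin sqr_ge0.
- under eq_fun do rewrite normc_sqr.
  by apply/measurable_EFinP; apply: measurable_funD; exact: measurable_funX.
- under eq_fun do rewrite normc_sqr.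
  by apply/measurable_EFinP; apply: measurable_funD; exact: measurable_funX.
- move=> t; rewrite RposE => t0; rewrite lee_fin /opM normcM normcR.
  rewrite ger0_norm ?expR_ge0// exprMn ler_piMl ?sqr_ge0// expr_le1 ?expR_ge0//.
  by rewrite -expR0 ler_expR oppr_le0 ltW.
Qed.

Variable phi : R -> R[i].
Hypothesis phi2 : L2m phi.

Lemma cintegrable_bc t : 0 < t ->
  cintegrable_on m Rpos (fun s => (bessel_clifford 0 (s * t))%:C * phi s).
Proof.
move=> t0; have mP := @measurable_Rpos R.
apply: (cintegrable_le mP (g := L2_bound phi)); last exact: L2m_integrable.
- apply: cmeasurableM; last exact: L2m_cmeasurable.
  apply: cmeasurableR; apply: measurable_funTS; apply: continuous_measurable_fun => s.
  apply: (@continuous_comp _ _ _ (fun s => s * t) (bessel_clifford 0)).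
    by apply: cvgM; [exact: cvg_id|exact: cvg_cst].
  exact: continuous_bc.
- move=> s; rewrite RposE => s0; rewrite normcM normcR.
  apply: le_trans (normc_le_L2_bound phi s); rewrite ler_piMl ?normc_ge0//.
  by rewrite norm_bc_le1// ltW// mulr_gt0.
Qed.

Lemma opK_bc t : 0 < t ->
  opK phi t = cint_on m Rpos (fun s => (bessel_clifford 0 (s * t))%:C * phi s).
Proof.
move=> t0; apply: (eq_cint m) => s; rewrite RposE => s0.
by rewrite kerKE.
Qed.

Lemma cintegrable_kerK t : 0 < t -> cintegrable (fun s => (kerK t s)%:C * phi s).
Proof.
move=> t0; have [h1 h2] := cintegrable_bc t0.
by split; [move: h1|move: h2]; apply: eq_integrable; rewrite ?inE;
  [exact: measurable_Rpos| |exact: measurable_Rpos|];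
  move=> s /set_mem; rewrite RposE => s0 /=; rewrite kerKE.
Qed.

Definition opK_bound : R := 2 * \int[m]_(s in Rpos) L2_bound phi s.

Lemma normc_opK_le t : 0 < t -> normc (opK phi t) <= opK_bound.
Proof.
move=> t0; rewrite opK_bc//; apply: normc_cint.
- exact: measurable_Rpos.
- exact: (cintegrable_cmeasurable (cintegrable_bc t0)).
- move=> s; rewrite RposE => s0; rewrite normcM normcR.
  apply: le_trans (normc_le_L2_bound phi s); rewrite ler_piMl ?normc_ge0//.
  by rewrite norm_bc_le1// ltW// mulr_gt0.
- exact: L2m_integrable.
Qed.

(** The weight [E] is left general for two uses: [t e^(-tu)] for the Laplace identity, and [e^(-t)]
    for the measurability of [K phi]. *)
Lemma opK_Fubini (E : R -> R[i]) (g : R -> R) :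
  cmeasurable (Rpos : set (measurableTypeR R)) E ->
  (forall t, Rpos t -> normc (E t) <= g t) ->
  lam.-integrable Rpos (EFin \o g) ->
  cmeasurable (Rpos : set (measurableTypeR R)) (fun t => E t * opK phi t) /\
  cint_on lam Rpos (fun t => E t * opK phi t) =
  cint_on m Rpos (fun s =>
    cint_on lam Rpos (fun t => E t * (bessel_clifford 0 (s * t))%:C) * phi s).
Proof.
move=> mE Eg ig; have mP := @measurable_Rpos R.
pose F (x : measurableTypeR R * R) : R[i] :=
  E x.1 * ((bessel_clifford 0 (x.2 * x.1))%:C * phi x.2).
have mF : cmeasurable (Rpos `*` Rpos) F.
  apply: cmeasurableM.
    have [h1 h2] := mE; split.
    - apply: (measurable_comp mRpos _ h1) => [_ [x [? ?] <-]//|].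
      by apply: measurable_funTS; exact: measurable_fst.
    - apply: (measurable_comp mRpos _ h2) => [_ [x [? ?] <-]//|].
      by apply: measurable_funTS; exact: measurable_fst.
  apply: cmeasurableM.
    apply: cmeasurableR; apply: measurable_funTS.
    apply: (measurableT_comp (f := bessel_clifford 0)).
      by apply: continuous_measurable_fun; exact: continuous_bc.
    by apply: measurable_funM; [exact: measurable_snd|exact: measurable_fst].
  have [h1 h2] := L2m_cmeasurable phi2; split.
  - apply: (measurable_comp mP _ h1) => [_ [x [? ?] <-]//|].
    by apply: measurable_funTS; exact: measurable_snd.
  - apply: (measurable_comp mP _ h2) => [_ [x [? ?] <-]//|].
    by apply: measurable_funTS; exact: measurable_snd.
have Fb t s : Rpos t -> Rpos s -> normc (F (t, s)) <= g t * L2_bound phi s.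
  move=> Dt; rewrite RposE => s0; rewrite /F /= normcM.
  apply: ler_pM; rewrite ?normc_ge0 ?Eg// normcM normcR.
  apply: le_trans (normc_le_L2_bound phi s); rewrite ler_piMl ?normc_ge0//.
  by move: Dt; rewrite RposE => t0; rewrite norm_bc_le1// ltW// mulr_gt0.
have [||h1 h2] := cFubini_on mRpos mP mF Fb ig (L2m_integrable phi2).
- by move=> t Dt; apply: le_trans (Eg t Dt); exact: normc_ge0.
- by move=> s _; exact: L2_bound_ge0.
have e t : Rpos t -> cint_on m Rpos (fun s => F (t, s)) = E t * opK phi t.
  by rewrite RposE => t0; rewrite opK_bc// -cintZ//; exact: cintegrable_bc.
split; first exact: (eq_cmeasurable e h1).
rewrite -(eq_cint lam e) h2; apply: (eq_cint m) => s Ds.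
rewrite mulrC -(cintZ mRpos).
  by apply: (eq_cint lam) => t Dt; rewrite /F /=; ring.
apply: (cintegrable_le mRpos _ _ ig).
- apply: cmeasurableM => //.
  apply: cmeasurableR; apply: measurable_funTS; apply: continuous_measurable_fun => t.
  apply: (@continuous_comp _ _ _ (fun t => s * t) (bessel_clifford 0)).
    by apply: cvgM; [exact: cvg_cst|exact: cvg_id].
  exact: continuous_bc.
- move=> t Dt; rewrite normcM normcR; apply: le_trans (Eg t Dt).
  rewrite ler_piMr ?normc_ge0//.
  by move: Ds Dt; rewrite !RposE => s0 t0; rewrite norm_bc_le1// ltW// mulr_gt0.
Qed.

(** Exchanging the integrals and evaluating the inner one with [laplace_bessel_clifford] turns the
    kernel into [u^(-2) e^(-s/u)]. The density of [m] is absent on the right; it reappears only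
    after summation over [n]. *)
Lemma laplace_inv u : 0 < complex.Re u ->
  u^-1 ^+ 2 * laplace phi u^-1 =
  cint_on lam Rpos (fun t => pow_exp u 1 t * opK phi t) /\
  cmeasurable (Rpos : set (measurableTypeR R)) (fun t => pow_exp u 1 t * opK phi t) /\
  cintegrable_on lam Rpos (fun t => pow_exp u 1 t * opK phi t).
Proof.
move=> u0; have mP := @measurable_Rpos R.
have a2 : 0 < complex.Re u / 2 by rewrite divr_gt0.
pose g t := 1`!%:R * (complex.Re u / 2)^-1 ^+ 1 * expR (- (complex.Re u / 2 * t)).
have ig : lam.-integrable Rpos (EFin \o g).
  exact: (integrable_scale mRpos _ (integrable_expRNM a2)).
have Eg t : Rpos t -> normc (pow_exp u 1 t) <= g t.
  by rewrite RposE => t0; apply: normc_pow_exp_le => //; exact: ltW.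
have [h1 h2] := opK_Fubini
  (cintegrable_cmeasurable (cintegrable_pow_exp u0 1)) Eg ig.
split; last first.
  split => //; apply: (cintegrable_le mRpos h1 (g := fun t => opK_bound * g t)).
  - move=> t Dt; rewrite normcM mulrC; apply: ler_pM; rewrite ?normc_ge0 ?Eg//.
    by move: Dt; rewrite RposE => t0; exact: normc_opK_le.
  - exact: (integrable_scale mRpos _ ig).
rewrite h2 /laplace -[cintegral _]/(cint_on m Rpos _) -cintZ//.
  by apply: (eq_cint m) => s; rewrite RposE => s0; rewrite laplace_bessel_clifford// mulrA.
(* Inversion preserves the right half-plane, hence [|e^(-s/u)| <= 1] and [L2_bound] dominates the
   integrand. *)
have ui0 : 0 <= complex.Re u^-1.
  by case: (u) u0 => x y /= x0; rewrite divr_ge0 ?addr_ge0 ?sqr_ge0// ltW.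
apply: (cintegrable_le mP _ _ (L2m_integrable phi2)).
- apply: cmeasurableM; last exact: L2m_cmeasurable.
  apply: (eq_cmeasurable (F := fun s => expC (s%:C * - u^-1))).
    by move=> s _; rewrite mulrN.
  exact: (cmeasurable_derivable mP (cderive_expC (- u^-1))).
- move=> s; rewrite RposE => s0; rewrite normcM normc_expC.
  apply: le_trans (normc_le_L2_bound phi s); rewrite ler_piMl ?normc_ge0//.
  rewrite -expR0 ler_expR -mulrN ReM /= mul0r subr0.
  by rewrite mulr_ge0_le0 ?(ltW s0)//; move: ui0; case: (u^-1) => a b /=; rewrite oppr_le0.
Qed.

End laplace_kernel.

(** * The generating series *)

Section transfer_operator.
Context {R : realType}.
Local Notation lam := (@lebesgue_measure R).
Implicit Types (phi : R -> R[i]) (s t : R) (u w z : R[i]).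

Let mRpos : measurable (Rpos : set (measurableTypeR R)).
Proof. exact: measurable_Rpos. Qed.

(** The inverse is the conjugate over the squared modulus, which reduces the claim to the continuity
    of the reciprocal on positive reals. *)
Lemma cmeasurableV (F : R -> R[i]) : cmeasurable Rpos F ->
  (forall t, Rpos t -> F t != 0) -> cmeasurable Rpos (fun t => (F t)^-1).
Proof.
move=> [mr mi] F0; have mP := @measurable_Rpos R.
pose N t := complex.Re (F t) ^+ 2 + complex.Im (F t) ^+ 2.
have mN : measurable_fun Rpos N by apply: measurable_funD; exact: measurable_funX.
have mI : measurable_fun Rpos (fun x : R => x^-1).
  apply: open_continuous_measurable_fun; first exact: interval_open.
  move=> t; rewrite inE RposE => t0.
  by apply: cvgV; [rewrite gt_eqF|exact: cvg_id].
have mNI : measurable_fun Rpos (fun t => (N t)^-1).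
  apply: (measurable_comp mP _ mI mN) => _ [t Dt <-]; rewrite RposE /N -normc_sqr.
  rewrite exprn_gt0// lt_neqAle normc_ge0 andbT eq_sym.
  by apply/eqP => /eq0_normc /eqP; apply/negP/F0.
split.
- apply: (eq_measurable_fun (fun t => complex.Re (F t) * (N t)^-1)).
    by move=> t _; rewrite /N; case: (F t).
  exact: measurable_funM.
- apply: (eq_measurable_fun (fun t => - (complex.Im (F t) * (N t)^-1))).
    by move=> t _; rewrite /N; case: (F t) => a b /=; rewrite ?mulNr.
  by apply: measurableT_comp => //; exact: measurable_funM.
Qed.

Lemma cmeasurable_expRN : cmeasurable Rpos (fun t : R => (expR (- t))%:C).
Proof.
apply: cmeasurableR; apply: measurable_funTS.
apply: (measurableT_comp (@measurable_expR R)); exact: oppr_measurable.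
Qed.

Variable z : R[i].
Hypothesis z1 : `|z| <= 1.

Let z1c : normc z <= 1.
Proof. by move: z1; rewrite normC_normc lecR. Qed.

Variable phi : R -> R[i].
Hypothesis phi2 : L2m phi.

(** Fubini gives measurability only together with an integrable weight, so [e^(-t)] is inserted and
    afterwards cancelled by [e^t]. *)
Lemma cmeasurable_opK : cmeasurable Rpos (opK phi).
Proof.
have mE : cmeasurable (Rpos : set (measurableTypeR R))
    (fun t : R => (expR (- (1 * t)))%:C).
  apply: cmeasurableR; apply: measurable_funTS.
  by apply: continuous_measurable_fun; exact: continuous_expRNM.
have [|h _] := opK_Fubini phi2 mE _ (integrable_expRNM ltr01).
  by move=> t _; rewrite normcR ger0_norm// expR_ge0.
apply: (@eq_cmeasurable _ _ _ _
    (fun t => (expR t)%:C * ((expR (- (1 * t)))%:C * opK phi t))).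
  by move=> t _; rewrite mulrA -realcM -expRD mul1r subrr expR0 mul1r.
by apply: cmeasurableM h; apply: cmeasurableR; apply: measurable_funTS;
  exact: measurable_expR.
Qed.

Lemma L2m_opK : L2m (opK phi).
Proof.
apply: (L2m_bounded (C := opK_bound phi)); first exact: cmeasurable_opK.
by move=> t; rewrite RposE; exact: normc_opK_le.
Qed.

Lemma normc_zexp_lt1 t : Rpos t -> normc (z * (expR (- t))%:C) < 1.
Proof.
rewrite RposE => t0; rewrite normcM normcR ger0_norm ?expR_ge0//.
have : expR (- t) < 1 by rewrite expR_lt1 oppr_lt0.
move: (expR_ge0 (- t)) (normc_ge0 z) z1c; nra.
Qed.

Lemma cmeasurable_opT : cmeasurable Rpos (fun t => z * opT z (opK phi) t).
Proof.
apply: cmeasurableZ; rewrite /opT; apply: cmeasurableM; last exact: cmeasurable_opK.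
have m1 (c : R[i]) : cmeasurable Rpos (fun t => 1 - c * (expR (- t))%:C).
  apply: (eq_cmeasurable (F := fun t => 1 + (- c) * (expR (- t))%:C)).
    by move=> t _; rewrite mulNr.
  have [h1 h2] := cmeasurableZ (- c) cmeasurable_expRN; split.
  - under eq_fun do rewrite ReD.
    by apply: measurable_funD => //; exact: measurable_cst.
  - under eq_fun do rewrite ImD.
    by apply: measurable_funD => //; exact: measurable_cst.
apply: cmeasurableM.
  by apply: eq_cmeasurable (m1 1) => t _; rewrite mul1r.
apply: cmeasurableV; first exact: m1.
by move=> t Dt; exact: one_sub_zM_neq0.
Qed.

Lemma L2m_opT : L2m (fun t => z * opT z (opK phi) t).
Proof.
apply: (L2m_bounded (C := opK_bound phi)); first exact: cmeasurable_opT.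
move=> t /[dup] Dt; rewrite RposE => t0; rewrite /opT.
have hK := normc_opK_le phi2 t0.
have e0 := expR_ge0 (- t).
have e1 : expR (- t) < 1 by rewrite expR_lt1 oppr_lt0.
(* Since [|z| <= 1], the triangle inequality bounds the denominator below by the numerator. The
   multiplier has modulus at most 1, even for [|z| = 1]. *)
have hd : 1 - expR (- t) <= normc (1 - z * (expR (- t))%:C).
  have := normcD_le (1 - z * (expR (- t))%:C) (z * (expR (- t))%:C).
  rewrite subrK normc1 (normcM z) normcR ger0_norm// => h.
  by have := normc_ge0 z; move: z1c h; nra.
have hn : normc (1 - (expR (- t))%:C : R[i]) = 1 - expR (- t).
  by rewrite -(rmorph1 (real_complex R)) -rmorphB normcR ger0_norm// subr_ge0 ltW.
rewrite (normcM z) (normcM (_ / _)) (normcM (1 - _)) normcV hn.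
apply: le_trans hK; rewrite mulrA ler_piMl ?normc_ge0//.
apply: (le_trans (ler_piMl _ z1c)).
  by rewrite mulr_ge0 ?invr_ge0 ?normc_ge0// subr_ge0 ltW.
rewrite ler_pdivrMr ?mul1r//.
by apply: lt_le_trans hd; rewrite subr_gt0.
Qed.

(** [laplace_inv] applies at [u = w + n] because [n >= 1] and [Re w > -1/2] give [Re u > 0]; then
    [e^(-t(w+n)) = e^(-tw) (e^(-t))^n] collects the powers of [z e^(-t)]. *)
Lemma opQ_partialE w N : halfplane w ->
  opQ_partial z (laplace phi) w N = cint_on lam Rpos (fun t =>
    (\sum_(1 <= n < N.+1) (z * (expR (- t))%:C) ^+ n) * (pow_exp w 1 t * opK phi t)) /\
  cmeasurable (Rpos : set (measurableTypeR R)) (fun t =>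
    (\sum_(1 <= n < N.+1) (z * (expR (- t))%:C) ^+ n) * (pow_exp w 1 t * opK phi t)).
Proof.
rewrite /halfplane /= => wh.
have un n : 0 < complex.Re (w + n.+1%:R).
  by rewrite ReD Re_nat -natr1; have := ler0n R n; lra.
pose G n t : R[i] := z ^+ n.+1 * (pow_exp (w + n.+1%:R) 1 t * opK phi t).
have iG n : cintegrable_on lam Rpos (G n).
  by apply: (cintegrableZ mRpos); have [_ []] := laplace_inv phi2 (un n).
have GE t : (\sum_(1 <= n < N.+1) (z * (expR (- t))%:C) ^+ n) * (pow_exp w 1 t * opK phi t) =
    \sum_(0 <= n < N) G n t.
  rewrite big_add1 /= mulr_suml; apply: eq_bigr => n _.
  rewrite /G mulrA mulrA; congr (_ * _).
  rewrite exprMn -mulrA; congr (_ * _); rewrite /pow_exp mulrCA; congr (_ * _).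
  rewrite mulrDr opprD expCD mulrC; congr (_ * _).
  rewrite -expCR -expCMn; congr expC.
  by rewrite mulr_natr -mulNrn rmorphN.
have [_ e] := cint_sum mRpos (index_iota 0 N) iG.
split.
- rewrite (eq_cint lam (fun t _ => GE t)) e /opQ_partial big_add1 /=.
  apply: eq_bigr => n _; rewrite -mulrA.
  have [-> [_ h]] := laplace_inv phi2 (un n).
  by rewrite -(cintZ mRpos).
- apply: (@eq_cmeasurable _ _ _ _ (fun t => \sum_(0 <= n < N) G n t)).
    by move=> t _; rewrite GE.
  by apply: cmeasurable_sum => n; exact: (cintegrable_cmeasurable (iG n)).
Qed.

Lemma sum_pow_le N (r : R) : 0 <= r -> r < 1 ->
  \sum_(1 <= n < N.+1) r ^+ n <= r / (1 - r).
Proof.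
move=> r0 r1; have d0 : 0 < 1 - r by rewrite subr_gt0.
rewrite ler_pdivlMr//.
suff -> : (\sum_(1 <= n < N.+1) r ^+ n) * (1 - r) = r - r ^+ N.+1.
  by rewrite lerBlDr lerDl exprn_ge0.
elim: N => [|N IH]; first by rewrite big_geq// mul0r expr1 subrr.
by rewrite big_nat_recr//= mulrDl IH !exprS; ring.
Qed.

Lemma sum_pow_ccvg (q : R[i]) : normc q < 1 ->
  ccvg (fun N => \sum_(1 <= n < N.+1) q ^+ n) (q / (1 - q)).
Proof.
move=> q1.
have d0 : 1 - q != 0.
  rewrite subr_eq0; apply: contraTneq q1 => <-.
  by rewrite normc1 ltxx.
apply: (@ccvg_normc _ _ _ (fun N => normc q / normc (1 - q) * normc q ^+ N)); last first.
  rewrite -[X in _ --> X](mulr0 (normc q / normc (1 - q))).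
  apply: cvgM; first exact: cvg_cst.
  by apply: cvg_expr; rewrite ger0_norm// normc_ge0.
move=> N.
have -> : \sum_(1 <= n < N.+1) q ^+ n - q / (1 - q) = - (q / (1 - q) * q ^+ N).
  apply: (mulIf d0); elim: N => [|N IH].
    by rewrite big_geq// expr0; field.
  rewrite big_nat_recr//= -addrA [q ^+ _ + _]addrC addrA mulrDl IH exprS.
  by field.
by rewrite normc_opp (normcM (_ / _)) (normcM q) normcV normcX.
Qed.

(** The geometric sums converge at every [t > 0], where [|z e^(-t)| < 1], though not uniformly near
    0 when [z = 1]; dominated convergence passes to the limit in [N]. *)
Lemma opQ_partial_ccvg w : halfplane w ->
  ccvg (opQ_partial z (laplace phi) w)
    (laplace (fun t => z * opT z (opK phi) t) w).
Proof.
move=> wh; have wre : - 2^-1 < complex.Re w by [].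
pose F N t : R[i] :=
  (\sum_(1 <= n < N.+1) (z * (expR (- t))%:C) ^+ n) * (pow_exp w 1 t * opK phi t).
pose q t := z * (expR (- t))%:C.
pose F_ t : R[i] := q t / (1 - q t) * (pow_exp w 1 t * opK phi t).
pose G t := expC (- (t%:C * w)) * (z * opT z (opK phi) t).
have c0 : 0 < complex.Re w + 2^-1 by lra.
have mG : cmeasurable Rpos G.
  apply: cmeasurableM; last exact: cmeasurable_opT.
  apply: (eq_cmeasurable (F := fun s => expC (s%:C * - w))).
    by move=> s _; rewrite mulrN.
  exact: (cmeasurable_derivable (@measurable_Rpos R) (cderive_expC (- w))).
(* The density converts the numerator [1 - e^(-t)] of the multiplier into [t e^(-t)], that is, into
   the weight times the numerator of the geometric limit. *)
have F_E t : Rpos t -> (m_density t)%:C * G t = F_ t.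
  move=> /[dup] Dt; rewrite RposE => t0; rewrite /F_ /G /opT /q /pow_exp.
  have h1 := one_sub_zM_neq0 z1 Dt.
  have et : expR t - 1 != 0 by rewrite gt_eqF// subr_gt0 expR_gt1.
  have ee : expR (- t) * expR t = 1 by rewrite -expRD addNr expR0.
  have hd : (m_density t)%:C * (1 - (expR (- t))%:C) = t%:C * (expR (- t))%:C.
    rewrite -[1 - _]/(1%:C - (expR (- t))%:C) -rmorphB -!realcM; congr (_ %:C).
    apply: (mulIf et); rewrite /m_density mulrAC mulfVK// mulrBr mulr1 -mulrA mulrBr ee.
    by ring.
  rewrite expr1.
  transitivity ((m_density t)%:C * (1 - (expR (- t))%:C) * (expC (- (t%:C * w)) *
    (z / (1 - z * (expR (- t))%:C) * opK phi t))); first by ring.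
  by rewrite hd; ring.
have -> : laplace (fun t => z * opT z (opK phi) t) w = cint_on lam Rpos F_.
  have [mr mi] := mG.
  rewrite -(eq_cint lam F_E) /laplace -[cintegral _]/(cint_on m Rpos G).
  apply: complex_eq; rewrite /= Rintegral_m//; apply: eq_Rintegral => t _.
    by rewrite (ReM (m_density t)%:C) /= mul0r subr0 mulrC.
  by rewrite (ImM (m_density t)%:C) /= mul0r addr0 mulrC.
have mF N := (opQ_partialE N wh).2.
have -> : opQ_partial z (laplace phi) w = (fun N => cint_on lam Rpos (F N)).
  by apply/funext => N; have [] := opQ_partialE N wh.
(* The geometric bound times [t] is [m_density t <= 2 e^(-t/2)]; with [e^(-t Re w)] the rate becomes
   [Re w + 1/2], positive exactly on the half-plane. *)
apply: (cint_dominated mRpos (g := fun t =>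
  2 * opK_bound phi * expR (- ((complex.Re w + 2^-1) * t)))).
- exact: mF.
- apply: eq_cmeasurable F_E _; apply: cmeasurableM => //.
  by apply: cmeasurableR; exact: measurable_m_density.
- move=> t Dt; apply: ccvgM; last exact: ccvg_cst.
  by apply: sum_pow_ccvg; exact: normc_zexp_lt1.
- exact: (integrable_scale mRpos _ (integrable_expRNM c0)).
- move=> N t /[dup] Dt; rewrite RposE => t0; rewrite /F.
  rewrite (normcM (\sum_(1 <= n < N.+1) _)) (normcM (pow_exp w 1 t)).
  have e0 := expR_ge0 (- t).
  have e1 : expR (- t) < 1 by rewrite expR_lt1 oppr_lt0.
  have hs : normc (\sum_(1 <= n < N.+1) (z * (expR (- t))%:C) ^+ n)
      <= expR (- t) / (1 - expR (- t)).
    apply: le_trans (sum_pow_le N e0 e1).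
    apply: le_trans (normc_sum _ _ _) _; apply: ler_sum => n _.
    rewrite normcX lerXn2r ?nnegrE ?normc_ge0//.
    by rewrite normcM normcR [X in _ * X]ger0_norm// ler_piMl.
  have hp : normc (pow_exp w 1 t) = t * expR (- (complex.Re w * t)).
    by rewrite normc_pow_exp ?expr1// ltW.
  have hK := normc_opK_le phi2 t0.
  have K0 : 0 <= opK_bound phi by apply: le_trans hK; exact: normc_ge0.
  rewrite hp; apply: le_trans
    (ler_pM (normc_ge0 _) _ hs (ler_wpM2l _ hK)) _.
  + by rewrite !mulr_ge0 ?expR_ge0 ?normc_ge0// ltW.
  + by rewrite mulr_ge0 ?expR_ge0// ltW.
  have hd : expR (- t) / (1 - expR (- t)) * t = m_density t.
    rewrite /m_density expRN; field; rewrite !gt_eqF ?expR_gt0//.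
    by rewrite subr_gt0 expR_gt1.
  have := m_density_le t0; rewrite -hd => hd2.
  have -> : expR (- ((complex.Re w + 2^-1) * t)) =
      expR (- (2^-1 * t)) * expR (- (complex.Re w * t)).
    by rewrite -expRD; congr expR; ring.
  have := ler_wpM2r (mulr_ge0 (expR_ge0 (- (complex.Re w * t))) K0) hd2.
  by congr (_ <= _); ring.
Qed.

End transfer_operator.

(** * The series operator on functions of the half-plane *)

Section operator_Q.
Context {R : realType}.
Implicit Types (phi : R -> R[i]) (w z : R[i]).

Lemma halfplane_inv w n : halfplane w -> halfplane ((w + n.+1%:R)^-1).
Proof.
rewrite /halfplane /= => wh.
have un : 0 < complex.Re (w + n.+1%:R).
  by rewrite ReD Re_nat -natr1; have := ler0n R n; lra.
case: (w + _) un => x y /= x0.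
have : 0 <= x / (x ^+ 2 + y ^+ 2) by rewrite divr_ge0 ?addr_ge0 ?sqr_ge0// ltW.
lra.
Qed.

(** The points [1/(w+n)] stay in the half-plane, so the operator depends only on values there and
    [f] may be replaced by its Laplace representation. *)
Lemma eq_opQ_partial z (f g : R[i] -> R[i]) w :
  (forall v, halfplane v -> f v = g v) -> halfplane w ->
  opQ_partial z f w = opQ_partial z g w.
Proof.
move=> fg wh; apply/funext => N; rewrite /opQ_partial !big_add1 /=.
by apply: eq_bigr => n _; rewrite fg//; exact: halfplane_inv.
Qed.

Lemma opQ_laplace z phi w : `|z| <= 1 -> L2m phi -> halfplane w ->
  opQ z (laplace phi) w = laplace (fun t => z * opT z (opK phi) t) w.
Proof.
(* [limn] has a default value on divergent sequences; actual convergence and separation of the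
   topology identify it with the limit found above. *)
move=> z1 phi2 wh; rewrite /opQ; apply: (@cvg_lim R[i]^o).
  exact: norm_hausdorff.
exact: (ccvg_cvg (opQ_partial_ccvg z1 phi2 wh)).
Qed.

End operator_Q.

Theorem proposition2 (R : realType) (z : R[i]) (z_neq0 : z != 0)
    (z_le1 : `|z| <= 1) :
  (forall f : R[i] -> R[i], H1 f ->
     (forall w : R[i], halfplane w -> cvgn (opQ_partial z f w)) /\
     H1 (opQ z f)) /\
  (forall phi : R -> R[i], L2m phi ->
     [/\ L2m (opM phi),
         (forall t : R, Rpos t ->
            cintegrable (fun s => (kerK t s)%:C * phi s)),
         L2m (opK phi),
         L2m (fun t => z * opT z (opK phi) t) &
         forall w : R[i], halfplane w ->
           opQ z (laplace phi) w =
           laplace (fun t => z * opT z (opK phi) t) w]).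
Proof.
split=> [f [phi phi2 fE]|phi phi2].
  split=> [w wh|].
    rewrite (eq_opQ_partial z fE wh).
    by apply/cvg_ex; eexists; exact: (ccvg_cvg (opQ_partial_ccvg z_le1 phi2 wh)).
  exists (fun t => z * opT z (opK phi) t); first exact: L2m_opT.
  by move=> w wh; rewrite -opQ_laplace// /opQ (eq_opQ_partial z fE wh).
split.
- exact: L2m_opM.
- by move=> t; rewrite RposE; exact: cintegrable_kerK.
- exact: L2m_opK.
- exact: L2m_opT.
- by move=> w wh; exact: opQ_laplace.
Qed.
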